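(* Let $H$ be a commutative hypergroup with Haar measure $\lambda$, let $\widehat{H}$ be its dual space equipped with the Plancherel measure $\pi$, and let $1<p\leq 2$. There is a constant $C>0$, independent of $\psi$ and $f$, such that the following holds. Suppose that $\psi$ is a positive measurable function on $\widehat{H}$ satisfying $$M_\psi := \sup_{t>0}\, t \int_{\{\chi\in\widehat{H}\,:\,\psi(\chi)\geq t\}} d\pi(\chi) <\infty .$$ Then for every $f\in L^p(H,d\lambda)$, $$\left( \int_{\widehat{H}} |\widehat{f}(\chi)|^p\, \psi(\chi)^{2-p}\, d\pi(\chi) \right)^{\frac{1}{p}} \leq C\, M_{\psi}^{\frac{2-p}{p}}\, \|f\|_{L^p(H,d\lambda)}.$$
   Context: A hypergroup is a nonempty locally compact Hausdorff space $H$ with a weakly continuous, associative convolution $*$ on the Banach space $M(H)$ of bounded regular Borel measures on $H$, making $(M(H),* )$ a Banach algebra, such that: (i) for all $x,y\in H$, $\delta_x*\delta_y$ is a probability measure with compact support ($\delta_x$ is the point mass at $x$), and $(x,y)\mapsto \mathrm{supp}(\delta_x*\delta_y)$ is continuous from $H\times H$ to the space of nonempty compact subsets of $H$ with the Michael (Vietoris) topology; (ii) there is a unique $e\in H$ with $\delta_x*\delta_e=\delta_e*\delta_x=\delta_x$ for all $x$; (iii) there is a homeomorphism $x\mapsto\check{x}$ of $H$ of order two which induces an involution on $M(H)$, where $\check{\mu}(E)=\mu(\check{E})$ for Borel sets $E$, and $e\in\mathrm{supp}(\delta_x*\delta_y)$ if and only if $x=\check{y}$. $H$ is commutative if $*$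 is commutative. Write $f(x*y)=\int_H f\,d(\delta_x*\delta_y)$. A Haar measure is a nonzero positive Radon measure $\lambda$ on $H$ with $\int_H f(x*y)\,d\lambda(y)=\int_H f(y)\,d\lambda(y)$ for all $x\in H$, $f\in C_c(H)$; it exists for commutative $H$ and is unique up to a scalar multiple. The dual space is $\widehat{H}=\{\chi : H\to\mathbb{C}\text{ bounded continuous}:\chi\neq0,\ \chi(\check{x})=\overline{\chi(x)},\ \chi(x*y)=\chi(x)\chi(y)\ \forall x,y\in H\}$, with the compact-open topology. The Fourier transform of $f\in L^1(H,\lambda)$ is $\widehat{f}(\chi)=\int_H f(x)\overline{\chi(x)}\,d\lambda(x)$. The Plancherel measure $\pi$ is the unique positive Borel measure on $\widehat{H}$ with $\int_H|f|^2d\lambda=\int_{\widehat{H}}|\widehat{f}|^2d\pi$ for all $f\in L^1(H,\lambda)\cap L^2(H,\lambda)$. For $1\le p\le2$, $\frac1p+\frac1{p'}=1$, the Hausdorff–Young inequality $\|\widehat{f}\|_{L^{p'}(\widehat{H},d\pi)}\le\|f\|_{L^p(H,d\lambda)}$ on $L^1\cap L^2$ is known, and $\widehat{f}$ for $f\in L^p(H,d\lambda)$ is defined by the resulting continuous extension. *)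

(* Defs.v *)
From HB Require Import structures.
From mathcomp Require Import all_boot all_order all_algebra.
From mathcomp Require Import all_classical all_reals all_analysis.
From mathcomp Require Import complex.

Set Implicit Arguments.
Unset Strict Implicit.
Unset Printing Implicit Defensive.

Import Order.TTheory GRing.Theory Num.Theory.
Import numFieldNormedType.Exports.

Local Open Scope classical_set_scope.
Local Open Scope ring_scope.
Local Open Scope complex_scope.

(* [R[i]] carries its topology only once it is viewed as a [numFieldType]. *)
Notation cplx R := (complex R : numFieldType).

Notation cabs := Normc.normc.

Notation borel T := (g_sigma_algebraType (@open T)).

Section complex_functions.
Context d (T : measurableType d) (R : realType).

Definition cmeasurable (f : T -> cplx R) :=
  measurable_fun setT (fun x => complex.Re (f x)) /\
  measurable_fun setT (fun x => complex.Im (f x)).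

Variable mu : {measure set T -> \bar R}.

Definition cintegral (f : T -> cplx R) : cplx R :=
  (\int[mu]_x complex.Re (f x)) +i* (\int[mu]_x complex.Im (f x)).

Definition cLnorm (p : \bar R) (f : T -> cplx R) : \bar R :=
  ('N[mu]_p[EFin \o (fun x => cabs (f x))])%E.

Definition cLp (p : \bar R) : set (T -> cplx R) :=
  [set f | cmeasurable f /\ (cLnorm p f < +oo)%E].

End complex_functions.

Section complex_measures.
Context d (T : measurableType d) (R : realType).

Record cmeasure := CMeasure {
  re_charge : {charge set T -> \bar R} ;
  im_charge : {charge set T -> \bar R} }.

Definition cm_val (mu : cmeasure) (A : set T) : cplx R :=
  fine (re_charge mu A) +i* fine (im_charge mu A).
Local Coercion cm_val : cmeasure >-> Funclass.

Definition cm_variation (mu : cmeasure) (A : set T) : \bar R :=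
  ereal_sup [set s | exists n (P : 'I_n -> set T),
    [/\ forall i, measurable (P i), trivIset setT P, forall i, P i `<=` A
      & s = (\sum_(i < n) cabs (mu (P i)))%:E]].

Definition cm_ge0 (mu : cmeasure) :=
  forall A, measurable A -> 0 <= mu A.

(* The integrals against the Jordan parts do not depend on the Hahn
   decomposition that is picked here. *)
Definition charge_integral (nu : {charge set T -> \bar R}) (f : T -> R) : R :=
  let PN := svalP (cid (svalP (cid (Hahn_decomposition nu)))) in
  \int[jordan_pos PN]_x f x - \int[jordan_neg PN]_x f x.

Lemma charge_integral_cst1 (nu : {charge set T -> \bar R}) :
  charge_integral nu (cst 1) = fine (nu setT).
Proof.
rewrite /charge_integral; cbv zeta; rewrite !Rintegral_cst// !mul1r.
pose PN := svalP (cid (svalP (cid (Hahn_decomposition nu)))).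
rewrite [in RHS](jordan_decomp PN)// /cadd/= cscaleN1.
by rewrite fineB ?fin_num_measure.
Qed.

Lemma charge_integral_cst0 (nu : {charge set T -> \bar R}) :
  charge_integral nu (cst 0) = 0.
Proof. by rewrite /charge_integral !Rintegral_cst// !mul0r subrr. Qed.

Definition cm_integral (mu : cmeasure) (f : T -> cplx R) : cplx R :=
  (charge_integral (re_charge mu) (fun x => complex.Re (f x)) -
   charge_integral (im_charge mu) (fun x => complex.Im (f x))) +i*
  (charge_integral (re_charge mu) (fun x => complex.Im (f x)) +
   charge_integral (im_charge mu) (fun x => complex.Re (f x))).

End complex_measures.

Coercion cm_val : cmeasure >-> Funclass.

Definition cm_regular (T : ptopologicalType) (R : realType)
    (mu : cmeasure (borel T) R) :=
  forall A : set (borel T), measurable A -> forall e : R, 0 < e ->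
    exists K U : set T, [/\ compact K, open U, K `<=` A, A `<=` U
      & (cm_variation mu (U `\` K) < e%:E)%E].

(* The space M(T).  Values of a charge on non-Borel sets are junk, so two
   elements are identified by [meq] rather than by Leibniz equality. *)
Record Mb (T : ptopologicalType) (R : realType) := MkMb {
  Mb_cmeasure :> cmeasure (borel T) R ;
  Mb_regular : cm_regular Mb_cmeasure }.

Definition meq (T : ptopologicalType) (R : realType) (mu nu : Mb T R) :=
  forall A : set (borel T), measurable A -> mu A = nu A.

Definition is_lincomb (T : ptopologicalType) (R : realType) (a : cplx R)
    (mu nu rho : Mb T R) :=
  forall A : set (borel T), measurable A -> rho A = a * mu A + nu A.

Definition bounded_continuous (T : topologicalType) (R : realType) :=
  {f : T -> cplx R | continuous f /\ exists M, forall x, cabs (f x) <= M}.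

(* M(T) is given the weak topology, induced by the bounded continuous
   functions. *)
Section weak_topology.
Context (T : ptopologicalType) (R : realType).

HB.instance Definition _ := gen_eqMixin (Mb T R).
HB.instance Definition _ := gen_choiceMixin (Mb T R).

Definition Mb_pairing (mu : Mb T R) :
    {ptws (bounded_continuous T R) -> (cplx R)} :=
  fun f => cm_integral mu (sval f).

HB.instance Definition _ :=
  Topological.copy (Mb T R) (initial_topology Mb_pairing).

End weak_topology.

Definition msupport (T : ptopologicalType) (R : realType) (mu : Mb T R) :
    set T :=
  [set x | forall U : set T, open U -> U x -> (0 < cm_variation mu U)%E].

(* Continuity for the Michael topology, which is generated by the sets
   [{A | A meets U and A `<=` V}] with [U] and [V] open. *)
Definition michael_continuous (X Y : topologicalType) (F : X -> set Y) :=
  forall U V : set Y, open U -> open V ->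
    open [set x | F x `&` U !=set0 /\ F x `<=` V].

Record lchSpace := LchSpace {
  lch_space :> ptopologicalType ;
  lch_hausdorff : hausdorff_space lch_space ;
  lch_locally_compact : locally_compact [set: lch_space] }.

Section point_masses.
Context (T : lchSpace) (R : realType).

Definition dirac_cmeasure (x : T) : cmeasure (borel T) R :=
  CMeasure (charge_of_finite_measure (@dirac _ (borel T) x R))
           (@czero _ (borel T) R).

Lemma dirac_cmeasureE x A : dirac_cmeasure x A = (x \in A)%:R%:C.
Proof. by rewrite /cm_val /= /charge_of_finite_measure /dirac indicE. Qed.

Lemma dirac_variation0 x A : ~ A x -> cm_variation (dirac_cmeasure x) A = 0%E.
Proof.
move=> nAx; apply/eqP; rewrite eq_le; apply/andP; split.
  apply: ge_ereal_sup => _ [n [P [_ _ PA ->]]]; rewrite big1// => i _.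
  by rewrite dirac_cmeasureE memNset; [exact: Normc.normc0|move=> /(PA i)].
apply: ereal_sup_ubound; exists 0%N, (fun=> set0); split; first by case.
- by case.
- by case.
- by rewrite big_ord0.
Qed.

Lemma dirac_regular x : cm_regular (dirac_cmeasure x).
Proof.
move=> A mA e e0; have [Ax|nAx] := pselect (A x).
  exists [set x], setT; split => //.
  - exact: compact_set1.
  - exact: openT.
  - by move=> _ ->.
  - by rewrite dirac_variation0 ?lte_fin// => -[_]; exact.
exists set0, (~` [set x]); split => //.
- exact: compact0.
- apply: closed_openC; apply: accessible_closed_set1.
  exact/hausdorff_accessible/lch_hausdorff.
- by move=> y Ay yx; apply: nAx; rewrite -yx.
- by rewrite dirac_variation0 ?lte_fin// => -[/(_ erefl)].
Qed.

Definition delta (x : T) : Mb T R := MkMb (dirac_regular x).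

End point_masses.
Arguments delta {T R}.

Section reflection.
Context (T : ptopologicalType) (R : realType) (f : T -> T).
Hypotheses (cf : continuous f) (ff : involutive f).

Lemma continuous_borel : @measurable_fun _ _ (borel T) (borel T) setT f.
Proof.
apply: (@measurability _ _ (borel T) (borel T) setT f open) => //.
move=> _ [B oB <-]; apply: sub_sigma_algebra; rewrite setTI.
by move/continuousP : cf; exact.
Qed.

Definition check_cmeasure (mu : cmeasure (borel T) R) : cmeasure (borel T) R :=
  CMeasure
    (measure_function_pushforward__canonical__charge_Charge (re_charge mu)
       continuous_borel)
    (measure_function_pushforward__canonical__charge_Charge (im_charge mu)
       continuous_borel).

Lemma check_cmeasureE mu A : check_cmeasure mu A = mu (f @^-1` A).
Proof. by []. Qed.

Lemma check_variation mu A :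
  (cm_variation (check_cmeasure mu) A <= cm_variation mu (f @^-1` A))%E.
Proof.
apply: ge_ereal_sup => _ [n [P [mP tP PA ->]]].
apply: ereal_sup_ubound; exists n, (fun i => f @^-1` P i); split => //.
- by move=> i; rewrite -[X in measurable X]setTI; exact: continuous_borel.
- by move=> i j _ _ [x [/= Pi Pj]]; apply: tP => //; exists (f x).
- by move=> i x /PA.
Qed.

Lemma check_regular (mu : Mb T R) : cm_regular (check_cmeasure mu).
Proof.
move=> A mA e e0.
have mfA : measurable (f @^-1` A : set (borel T)).
  by rewrite -[X in measurable X]setTI; exact: continuous_borel.
have [K [U [cK oU KA AU KU]]] := Mb_regular mu mfA e0.
exists (f @^-1` K), (f @^-1` U); split.
- have -> : f @^-1` K = f @` K.
    apply/seteqP; split => [x Kx|_ [y Ky <-]]; last by rewrite /= ff.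
    by exists (f x); rewrite ?ff.
  by apply: continuous_compact cK; exact: continuous_subspaceT.
- by move/continuousP : cf; exact.
- by move=> x /KA /=; rewrite ff.
- by move=> x Ax; apply: AU; rewrite /= ff.
- apply: le_lt_trans KU; apply: le_trans (check_variation _ _) _.
  suff -> : f @^-1` (f @^-1` U `\` f @^-1` K) = U `\` K by [].
  by apply/seteqP; split => x /=; rewrite ff.
Qed.

Definition check_Mb (mu : Mb T R) : Mb T R := MkMb (check_regular mu).

End reflection.

(* Completeness of M(H), needed for a Banach algebra, is automatic. *)
Record hypergroup (R : realType) := Hypergroup {
  hg_space :> lchSpace ;
  conv : Mb hg_space R -> Mb hg_space R -> Mb hg_space R ;
  conv_linear_l : forall a mu1 mu2 mu3 nu, is_lincomb a mu1 mu2 mu3 ->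
    is_lincomb a (conv mu1 nu) (conv mu2 nu) (conv mu3 nu) ;
  conv_linear_r : forall a nu1 nu2 nu3 mu, is_lincomb a nu1 nu2 nu3 ->
    is_lincomb a (conv mu nu1) (conv mu nu2) (conv mu nu3) ;
  conv_assoc : forall mu nu rho,
    meq (conv (conv mu nu) rho) (conv mu (conv nu rho)) ;
  conv_submultiplicative : forall mu nu,
    (cm_variation (conv mu nu) setT <=
     cm_variation mu setT * cm_variation nu setT)%E ;
  (* Weak continuity is required on the cone of positive measures only: on the
     whole of M(H), joint weak continuity already fails for the circle group. *)
  conv_weakly_continuous :
    {within [set mn : Mb hg_space R * Mb hg_space R |
              cm_ge0 mn.1 /\ cm_ge0 mn.2],
      continuous (fun mn => conv mn.1 mn.2)} ;
  conv_dirac_ge0 : forall x y,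
    cm_ge0 (conv (delta x) (delta y)) ;
  conv_dirac_setT : forall x y,
    conv (delta x) (delta y) setT = 1 ;
  conv_dirac_compact : forall x y,
    compact (msupport (conv (delta x) (delta y))) ;
  conv_dirac_michael : michael_continuous (fun xy : hg_space * hg_space =>
    msupport (conv (delta xy.1) (delta xy.2))) ;
  hg_unit : hg_space ;
  conv_dirac_unit : forall x,
    meq (conv (delta x) (delta hg_unit)) (delta x) /\
    meq (conv (delta hg_unit) (delta x)) (delta x) ;
  hg_unit_unique : forall e, (forall x,
    meq (conv (delta x) (delta e)) (delta x) /\
    meq (conv (delta e) (delta x)) (delta x)) -> e = hg_unit ;
  hg_check : hg_space -> hg_space ;
  hg_check_continuous : continuous hg_check ;
  hg_checkK : involutive hg_check ;
  conv_check : forall mu nu,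
    meq (check_Mb hg_check_continuous hg_checkK (conv mu nu))
        (conv (check_Mb hg_check_continuous hg_checkK nu)
              (check_Mb hg_check_continuous hg_checkK mu)) ;
  hg_unit_support : forall x y,
    msupport (conv (delta x) (delta y)) hg_unit <-> x = hg_check y }.

Section harmonic_analysis.
Context (R : realType) (H : hypergroup R).

Definition commutative_hypergroup := forall mu nu : Mb H R,
  meq (conv mu nu) (conv nu mu).

(* [translate f x y] is f(x * y). *)
Definition translate (f : H -> cplx R) (x y : H) : cplx R :=
  cm_integral (conv (delta x) (delta y)) f.

Definition Cc : set (H -> cplx R) :=
  [set f | continuous f /\ compact (closure [set x | f x != 0])].

Definition radon_measure (la : {measure set (borel H) -> \bar R}) :=
  [/\ forall K : set H, compact K -> (la K < +oo)%E,
      forall A : set (borel H), measurable A ->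
        la A = ereal_inf [set la U | U in [set U : set H | open U /\ A `<=` U]]
    & forall U : set H, open U ->
        la U = ereal_sup [set la K | K in [set K : set H | compact K /\ K `<=` U]]].

Definition haar_measure (la : {measure set (borel H) -> \bar R}) :=
  [/\ radon_measure la, la setT != 0%E
    & forall (x : H) (f : H -> cplx R), Cc f ->
        cintegral la (translate f x) = cintegral la f].

Definition hg_characters : set {compact-open, H -> (cplx R)} :=
  [set chi : H -> cplx R | [/\ continuous chi,
    exists M, forall x, cabs (chi x) <= M,
    exists x, chi x != 0,
    forall x, chi (hg_check x) = (chi x)^*
    & forall x y, translate chi x y = chi x * chi y]].

Lemma hg_characters1 : hg_characters (fun=> 1).
Proof.
split.
- by move=> x; exact: cvg_cst.
- by exists 1 => x; rewrite Normc.normc1.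
- by exists point; exact: oner_neq0.
- by move=> x; rewrite rmorph1.
- move=> x y; rewrite mulr1 /translate /cm_integral.
  rewrite !charge_integral_cst1 !charge_integral_cst0 subr0 add0r.
  exact: conv_dirac_setT.
Qed.

Definition hg_dual : Type := set_type hg_characters.

HB.instance Definition _ := Topological.copy hg_dual (set_type hg_characters).
HB.instance Definition _ :=
  isPointed.Build hg_dual (exist _ (fun=> 1) (mem_set hg_characters1)).

Definition character_fun (chi : hg_dual) : H -> cplx R := set_val chi.

Variable la : {measure set (borel H) -> \bar R}.

Definition fourier (f : H -> cplx R) (chi : hg_dual) : cplx R :=
  cintegral la (fun x => f x * (character_fun chi x)^*).

Variable pi : {measure set (borel hg_dual) -> \bar R}.

Definition plancherel_measure := forall f : H -> cplx R,
  cLp la 1%:E f -> cLp la 2%:E f ->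
  (\int[la]_x (cabs (f x) ^+ 2)%:E =
   \int[pi]_chi (cabs (fourier f chi) ^+ 2)%:E)%E.

(* [g] is (a representative of) the Fourier transform of [f] in L^p: the graph
   of the continuous extension is the closure in L^p * L^p' of the graph of
   [fourier] on the intersection of L^1 and L^2. *)
Definition Lp_fourier (p : R) (f : H -> cplx R) (g : hg_dual -> cplx R) :=
  cLp pi (hoelder_conjugate p%:E) g /\
  exists h : nat -> H -> cplx R,
    [/\ forall n, cLp la 1%:E (h n) /\ cLp la 2%:E (h n),
        cLnorm la p%:E (fun x => h n x - f x) @[n --> \oo] --> 0%E
      & cLnorm pi (hoelder_conjugate p%:E)
          (fun chi => fourier (h n) chi - g chi) @[n --> \oo] --> 0%E].

Definition weak_sup (psi : hg_dual -> R) : \bar R :=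
  ereal_sup [set (t%:E * pi [set chi | (t <= psi chi)%R])%E
            | t in [set t : R | 0 < t]].

End harmonic_analysis.

(* Main.v *)
Require Import Defs.
From HB Require Import structures.
From mathcomp Require Import all_boot all_order all_algebra.
From mathcomp Require Import all_classical all_reals all_analysis.
From mathcomp Require Import complex.
From mathcomp Require Import measurable_realfun ring lra.

Set Implicit Arguments.
Unset Strict Implicit.
Unset Printing Implicit Defensive.

Import Order.TTheory GRing.Theory Num.Theory.
Import numFieldNormedType.Exports.

Local Open Scope classical_set_scope.
Local Open Scope ring_scope.

(** The inequality is a weighted form of the Marcinkiewicz interpolation
    theorem.  Give the dual the measure nu of density psi^2 with respect to pi
    and put T h = |h^| / psi, where h^ is the Fourier transform of h.  The
    integral of |h^|^p psi^(2-p) against pi is the integral of (T h)^p against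
    nu, so the claim is that T is bounded from L^p(la) to L^p(nu).

    - T is of type (2,2): the squared norm of T h in L^2(nu) is that of h^ in
      L^2(pi), hence that of h, by Plancherel.
    - T is of weak type (1,1) with constant a multiple of M = M_psi: characters
      are bounded by 1 [cabs_character_le1], hence |h^| <= ||h||_1, and T h >= t
      forces psi <= ||h||_1 / t.  A decomposition of the values of psi into
      dyadic levels shows that the integral of psi^2 over [psi <= s] is at most
      8 M s [weak_type_integral_sqr_le].

    Cutting h at the height m t, with m a bound for M, and applying the first
    bound to the large part and the second one to the small part bounds
    nu [T h >= t] [fourier_weak_type].  The choice of the height makes both
    contributions scale in the same way, which is where the power m^(2-p) comes
    from.  Summing these bounds over t = 2^j gives the strong type (p,p)
    [marcinkiewicz_interpolation] for h in the intersection of L^1 and L^2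
    [paley_L1_L2].  For p = 2 the interpolation constant is infinite, but there
    the claim is Plancherel's formula.

    The passage to f in L^p approximates f by functions h_n in L^1 and L^2
    whose transforms converge in L^p' to that of f.  The sets where psi lies in
    a compact subset of the positive half-line have finite pi-measure, the
    function psi^(2-p) is bounded on them, and p <= p', so there the transforms
    also converge in L^p with weight psi^(2-p); these sets exhaust the dual
    [paley_Lp].

    Integrals of sums split only for measurable functions, so the argument also
    needs the Fourier transform of an integrable function to be Borel on the
    dual.  It is even continuous: by tightness [radon_integral_tight] only a
    compact part of the hypergroup matters, and on a compact set nearby
    characters are uniformly close [fourier_cmeasurable]. *)

(** An integral over a set is written as an integral over the whole space whose
    integrand is multiplied by the truth value of the defining condition. *)
Local Notation "[ind b ]" := ((nat_of_bool b%R)%:R) (format "[ind  b ]").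

(** * Geometric sums and integrals of nonnegative real functions *)

(** A geometric progression of ratio [q > 1] is dominated by its last term, and
    the last term that is counted is at most [U]. *)
Lemma geometric_sum_below (R : realType) (q s U : R) n :
  1 < q -> 0 <= s -> 0 <= U ->
  (q - 1) * \sum_(j < n) s * q ^+ j * [ind s * q ^+ j <= U] <= q * U.
Proof.
move=> q1 s0 U0.
have q0 : 0 < q by lra.
have full m : (q - 1) * \sum_(j < m) s * q ^+ j * [ind s * q ^+ j <= U]
    <= s * q ^+ m.
  elim: m => [|m IH]; first by rewrite big_ord0 mulr0 mulr_ge0// exprn_ge0// ltW.
  rewrite big_ord_recr/= mulrDr exprS.
  have x0 : 0 <= s * q ^+ m by rewrite mulr_ge0// exprn_ge0// ltW.
  have b1 : [ind s * q ^+ m <= U] <= 1 :> R by case: (_ <= U).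
  have : (q - 1) * (s * q ^+ m * [ind s * q ^+ m <= U]) <= (q - 1) * (s * q ^+ m).
    by rewrite ler_pM2l ?subr_gt0// ler_piMr.
  lra.
elim: n => [|n IH]; first by rewrite big_ord0 mulr0 mulr_ge0// ltW.
have [nU|nU] := leP (s * q ^+ n) U.
  apply: le_trans (full _) _.
  by rewrite exprS mulrCA ler_pM2l.
by rewrite big_ord_recr/= [s * q ^+ n <= U]leNgt nU/= mulr0 addr0.
Qed.

Section real_valued_integrals.
Context d (T : measurableType d) (R : realType).
Variable mu : {measure set T -> \bar R}.
Implicit Types f g : T -> R.

Lemma measurable_boolr (b : T -> bool) :
  measurable_fun setT b -> measurable_fun setT (fun x => [ind b x] : R).
Proof.
move=> mb; apply: (@measurableT_comp _ _ _ _ _ _ (fun c : bool => c%:R : R)) => //.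
Qed.

Lemma le_integral_real f g : measurable_fun setT f -> measurable_fun setT g ->
  (forall x, 0 <= f x) -> (forall x, f x <= g x) ->
  (\int[mu]_x (f x)%:E <= \int[mu]_x (g x)%:E)%E.
Proof.
move=> mf mg f0 fg; apply: ge0_le_integral => //.
- by move=> x _; rewrite lee_fin.
- exact/measurable_EFinP.
- exact/measurable_EFinP.
- by move=> x _; rewrite lee_fin.
Qed.

Lemma integralD_real f g : measurable_fun setT f -> measurable_fun setT g ->
  (forall x, 0 <= f x) -> (forall x, 0 <= g x) ->
  (\int[mu]_x (f x + g x)%:E = \int[mu]_x (f x)%:E + \int[mu]_x (g x)%:E)%E.
Proof.
move=> mf mg f0 g0; under eq_integral do rewrite EFinD.
apply: ge0_integralD => //.
- by move=> x _; rewrite lee_fin.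
- exact/measurable_EFinP.
- by move=> x _; rewrite lee_fin.
- exact/measurable_EFinP.
Qed.

Lemma integralZ_real (k : R) f : measurable_fun setT f ->
  (forall x, 0 <= f x) -> 0 <= k ->
  (\int[mu]_x (k * f x)%:E = k%:E * \int[mu]_x (f x)%:E)%E.
Proof.
move=> mf f0 k0; under eq_integral do rewrite EFinM.
apply: ge0_integralZl_EFin => //.
- by move=> x _; rewrite lee_fin.
- exact/measurable_EFinP.
Qed.

Lemma integral_sum_real n (f : nat -> T -> R) :
  (forall j, measurable_fun setT (f j)) -> (forall j x, 0 <= f j x) ->
  (\int[mu]_x (\sum_(j < n) f j x)%:E = \sum_(j < n) \int[mu]_x (f j x)%:E)%E.
Proof.
move=> mf f0; under eq_integral do rewrite -sumEFin.
have := @ge0_integral_sum _ _ _ mu setT measurableT _ (fun (j : 'I_n) x => (f j x)%:E).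
apply.
- by move=> j; exact/measurable_EFinP.
- by move=> j x _; rewrite lee_fin.
Qed.

Lemma measurable_sum_real n (f : nat -> T -> R) :
  (forall j, measurable_fun setT (f j)) ->
  measurable_fun setT (fun x => \sum_(j < n) f j x).
Proof. by move=> mf; apply: measurable_sum => j. Qed.

(** This form of monotone convergence reduces a dyadic decomposition of the
    values of a function to one with finitely many levels. *)
Lemma integral_le_exhaustion (b : nat -> T -> bool) f (B : \bar R) :
  (forall n, measurable_fun setT (b n)) -> measurable_fun setT f ->
  (forall x, 0 <= f x) ->
  (forall m n x, (m <= n)%N -> b m x -> b n x) ->
  (forall x, 0 < f x -> exists n, b n x) ->
  (forall n, (\int[mu]_x (f x * [ind b n x])%:E <= B)%E) ->
  (\int[mu]_x (f x)%:E <= B)%E.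
Proof.
move=> mb mf f0 ndb exb le_B.
have cvg x : ((f x * [ind b n x])%:E @[n --> \oo] --> (f x)%:E)%E.
  have [fx0|] := ltP 0 (f x); last first.
    move=> fx0; have -> : f x = 0 by apply/eqP; rewrite eq_le fx0 f0.
    by under eq_fun do rewrite mul0r; exact: cvg_cst.
  have [N bN] := exb x fx0.
  apply: (@cvg_near_cst _ (\bar R)) => //.
  by exists N => // n /= Nn; rewrite (ndb _ _ _ Nn bN) mulr1.
rewrite (eq_integral (fun x => limn (fun n => (f x * [ind b n x])%:E))); last first.
  by move=> x _; apply/esym/cvg_lim.
rewrite monotone_convergence//.
- apply: lime_le.
    apply: ereal_nondecreasing_is_cvgn; apply/nondecreasing_seqP => n.
    apply: le_integral_real => //.
    + by apply: measurable_funM => //; exact: measurable_boolr.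
    + by apply: measurable_funM => //; exact: measurable_boolr.
    + by move=> x; rewrite mulr_ge0.
    + move=> x; rewrite ler_wpM2l// ler_nat.
      by have := @ndb n n.+1 x (leqnSn n); case: (b n x) => // ->.
  by apply: nearW => n; exact: le_B.
- move=> n; apply/measurable_EFinP.
  by apply: measurable_funM => //; exact: measurable_boolr.
- by move=> n x _; rewrite lee_fin mulr_ge0.
- move=> x _; apply/nondecreasing_seqP => n; rewrite lee_fin ler_wpM2l// ler_nat.
  by have := @ndb n n.+1 x (leqnSn n); case: (b n x) => // ->.
Qed.

End real_valued_integrals.

(** * Dyadic scales *)

Section dyadic_scales.
Variable R : realType.
Implicit Types (t u v a p : R) (n j : nat).

Lemma powR2_gt1 a : 0 < a -> 1 < 2 `^ a.
Proof.
move=> a0; have := gt0_ltr_powR a0 ler01 (ler0n R 2).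
by rewrite powR1; apply; rewrite ltr1n.
Qed.

Lemma powR_dyadic t a j : 0 <= t -> (t * 2 ^+ j) `^ a = t `^ a * (2 `^ a) ^+ j.
Proof.
by move=> t0; rewrite powRM ?exprn_ge0// -powR_mulrn// powRAC powR_mulrn ?powR_ge0.
Qed.

Lemma dyadic_level t v n : t <= v -> v < t * 2 ^+ n ->
  exists j : 'I_n, t * 2 ^+ j <= v < t * 2 ^+ j.+1.
Proof.
elim: n => [|n IH] tv vn; first by exfalso; move: vn; rewrite expr0; lra.
have [vn'|nv] := ltP v (t * 2 ^+ n).
  by have [j] := IH tv vn'; exists (widen_ord (leqnSn n) j).
by exists ord_max; rewrite nv.
Qed.

(** The single level [t 2^j <= v < t 2^(j+1)] that contains [v] already bounds
    the left-hand side. *)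
Lemma powR_le_dyadic_sum p t v n : 0 <= p -> 0 < t ->
  t <= v -> v < t * 2 ^+ n ->
  v `^ p <= \sum_(j < n) (2 * (t * 2 ^+ j)) `^ p * [ind t * 2 ^+ j <= v].
Proof.
move=> p0 t0 tv vn; have [j /andP[jv vj]] := dyadic_level tv vn.
rewrite (bigD1 j)//= jv mulr1 ler_wpDr//.
  by apply: sumr_ge0 => i _; rewrite mulr_ge0// powR_ge0.
apply: ge0_ler_powR => //; rewrite ?nnegrE.
- by rewrite (le_trans (ltW t0)).
- by rewrite mulr_ge0// mulr_ge0// ?exprn_ge0// ltW.
by move: vj; rewrite exprS mulrCA => /ltW.
Qed.

(** The summands grow like [(2^a)^j], so the largest counted scale, which is
    less than [u], dominates. *)
Lemma dyadic_sum_below a t u n : 0 < a -> 0 < t -> 0 <= u ->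
  \sum_(j < n) (t * 2 ^+ j) `^ a * [ind t * 2 ^+ j < u] <=
  2 `^ a / (2 `^ a - 1) * u `^ a.
Proof.
move=> a0 t0 u0.
have q1 := powR2_gt1 a0.
rewrite mulrAC ler_pdivlMr ?subr_gt0// mulrC.
apply: le_trans (geometric_sum_below n q1 (powR_ge0 t a) (powR_ge0 u a)).
rewrite ler_pM2l ?subr_gt0//; apply: ler_sum => j _.
rewrite powR_dyadic ?(ltW t0)// ler_wpM2l//.
  by rewrite mulr_ge0 ?powR_ge0// exprn_ge0// powR_ge0.
rewrite -powR_dyadic ?(ltW t0)//; case: ltP => // tu; rewrite ler_nat.
suff -> : (t * 2 ^+ j) `^ a <= u `^ a by [].
apply: ge0_ler_powR (ltW tu); rewrite ?nnegrE// ?(ltW a0)//.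
by rewrite mulr_ge0 ?(ltW t0)// exprn_ge0.
Qed.

(** The summands decrease like [(2^b)^(-j)], so the smallest counted scale,
    which is at least [u], dominates. *)
Lemma dyadic_sum_above b t u n : 0 < b -> 0 < t -> 0 < u ->
  \sum_(j < n) (t * 2 ^+ j) `^ (- b) * [ind u <= t * 2 ^+ j] <=
  2 `^ b / (2 `^ b - 1) * u `^ (- b).
Proof.
move=> b0 t0 u0; case: n => [|n].
  rewrite big_ord0 mulr_ge0 ?powR_ge0// divr_ge0 ?powR_ge0// subr_ge0.
  exact/ltW/powR2_gt1.
have q1 := powR2_gt1 b0.
rewrite mulrAC ler_pdivlMr ?subr_gt0// mulrC.
have := geometric_sum_below n.+1 q1 (powR_ge0 (t * 2 ^+ n) (- b)) (powR_ge0 u (- b)).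
apply: le_trans; rewrite ler_pM2l ?subr_gt0//.
(* Read from the largest scale downwards, the summands increase. *)
rewrite (reindex_inj rev_ord_inj)/=; apply: ler_sum => j _; rewrite subSS.
have jn : (j <= n)%N by rewrite -ltnS.
have E : (t * 2 ^+ (n - j)) `^ (- b) = (t * 2 ^+ n) `^ (- b) * (2 `^ b) ^+ j.
  have -> : t * 2 ^+ n = t * 2 ^+ (n - j) * 2 ^+ j.
    by rewrite -mulrA -exprD subnK.
  rewrite [RHS]mulrC (@powR_dyadic (t * 2 ^+ (n - j))) ?mulr_ge0 ?exprn_ge0 ?(ltW t0)//.
  by rewrite mulrCA -exprMn (powRN 2) mulfV ?expr1n ?mulr1// gt_eqF// powR_gt0//.
rewrite E; apply: ler_wpM2l.
  by rewrite mulr_ge0 ?powR_ge0// exprn_ge0// powR_ge0.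
rewrite -E; case: (leP u _) => // ut; rewrite ler_nat.
suff -> : (t * 2 ^+ (n - j)) `^ (- b) <= u `^ (- b) by [].
rewrite !powRN lef_pV2 ?posrE ?powR_gt0//; last 1 first.
  by rewrite mulr_gt0// exprn_gt0.
apply: ge0_ler_powR; rewrite ?nnegrE ?(ltW b0) ?(ltW u0) ?(ltW ut)//.
by rewrite mulr_ge0 ?exprn_ge0 ?(ltW t0).
Qed.

End dyadic_scales.

(** * Weights of weak type *)

Lemma exists_pow2_gt (R : realType) (x : R) : exists N, x < 2 ^+ N.
Proof.
have [x0|x0] := ltP x 0; first by exists 0%N; rewrite expr0 (lt_trans x0).
exists (Num.bound x); apply: lt_trans (archi_boundP x0) _.
by rewrite -natrX ltr_nat ltn_expl.
Qed.

Section weak_type_weights.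
Context d (T : measurableType d) (R : realType).
Variable mu : {measure set T -> \bar R}.

Lemma integral_ind (v : T -> R) t : measurable_fun setT v ->
  (\int[mu]_x ([ind t <= v x])%:E = mu [set x | (t <= v x)%R])%E.
Proof.
move=> mv.
have mA : measurable [set x | t <= v x].
  rewrite -[X in measurable X]setTI.
  have := @measurable_fun_ler _ _ R setT (cst t) v (measurable_cst _) mv.
  by move=> /(_ measurableT [set true] I).
rewrite -[RHS]mul1e -integral_cst// [RHS]integral_mkcond.
apply: eq_integral => x _; rewrite patchE; case: ifPn.
  by rewrite inE/= => ->.
by rewrite notin_setE/= => /negP/negbTE ->.
Qed.

(** On the level [t <= psi < 2 t] the integrand is at most [4 t^2] and the level
    has measure at most [m / t], so it contributes at most [4 m t].  Summing over
    the dyadic scales [t <= s] costs another factor [2]. *)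
Lemma weak_type_integral_sqr_le (psi : T -> R) (m s : R) :
  measurable_fun setT psi -> (forall x, 0 < psi x) -> 0 <= m ->
  (forall t, (0 < t)%R -> (t%:E * mu [set x | (t <= psi x)%R] <= m%:E)%E) ->
  0 <= s ->
  (\int[mu]_x (psi x ^+ 2 * [ind psi x <= s])%:E <= (8 * m * s)%:E)%E.
Proof.
move=> mpsi psi0 m0 weak s0.
have mle t : measurable_fun setT (fun x => t <= psi x).
  exact: measurable_fun_ler.
have mge t : measurable_fun setT (fun x => psi x <= t).
  exact: measurable_fun_ler.
have mf : measurable_fun setT (fun x => psi x ^+ 2 * [ind psi x <= s]).
  apply: measurable_funM; first exact: measurable_funX.
  exact: measurable_boolr.
pose t N : R := s / 2 ^+ N.
apply: (integral_le_exhaustion (b := fun N x => t N <= psi x)) => //.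
- by move=> x; rewrite mulr_ge0 ?sqr_ge0.
- move=> M N x MN; apply: le_trans; rewrite ler_wpM2l// lef_pV2 ?posrE ?exprn_gt0//.
  by rewrite ler_weXn2l// ler1n.
- move=> x _; have [N sN] := exists_pow2_gt (s / psi x); exists N.
  by rewrite /t ler_pdivrMr ?exprn_gt0// mulrC -ler_pdivrMr// ltW.
move=> N; have [->|sn0] := eqVneq s 0.
  rewrite mulr0 (eq_integral (cst 0%E)) ?integral0// => x _.
  by rewrite [_ <= 0]leNgt psi0/= mulr0 mul0r.
have tN0 : 0 < t N by rewrite divr_gt0 ?exprn_gt0// lt_neqAle eq_sym sn0.
pose S j := t N * 2 ^+ j.
have S0 j : 0 < S j by rewrite mulr_gt0// exprn_gt0.
pose level j x : R := (2 * S j) ^+ 2 * [ind S j <= psi x].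
have mlevel j : measurable_fun setT (level j).
  by apply: measurable_funM => //; exact: measurable_boolr.
apply: (@le_trans _ _ (\int[mu]_x (\sum_(j < N.+1) level j x)%:E)%E).
  apply: le_integral_real => //.
  - apply: measurable_funM => //; exact: measurable_boolr.
  - exact: measurable_sum_real.
  - by move=> x; rewrite mulr_ge0// mulr_ge0 ?sqr_ge0.
  move=> x; case: (leP (psi x) s) => xs; last first.
    by rewrite mulr0 mul0r sumr_ge0// => j _; rewrite mulr_ge0 ?sqr_ge0.
  case: (leP (t N) (psi x)) => tx; last first.
    by rewrite !mulr0 sumr_ge0// => j _; rewrite mulr_ge0 ?sqr_ge0.
  rewrite !mulr1 -powR_mulrn ?(ltW (psi0 x))//.
  apply: le_trans (powR_le_dyadic_sum (n := N.+1) _ tN0 tx _) _ => //.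
    rewrite /t exprS mulrCA mulfVK ?gt_eqF ?exprn_gt0//.
    by rewrite (le_lt_trans xs)// ltr_pMl ?ltr1n// lt_neqAle eq_sym sn0.
  by apply: ler_sum => j _; rewrite powR_mulrn// mulr_ge0// ltW// S0.
rewrite integral_sum_real//; last by move=> j x; rewrite mulr_ge0 ?sqr_ge0.
apply: (@le_trans _ _ (\sum_(j < N.+1) (4 * m * S j)%:E)%E).
  apply: lee_sum => j _.
  rewrite integralZ_real ?sqr_ge0//; last exact: measurable_boolr.
  rewrite integral_ind//.
  have -> : (2 * S j) ^+ 2 = 4 * S j * S j by rewrite exprMn expr2; ring.
  rewrite EFinM -muleA [X in (_ <= X)%E](_ : _ = (4 * S j)%:E * m%:E)%E; last first.
    by rewrite -EFinM; congr EFin; ring.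
  by rewrite lee_wpmul2l ?lee_fin ?mulr_ge0 ?(ltW (S0 _))// weak.
rewrite sumEFin lee_fin -mulr_sumr.
have -> : \sum_(j < N.+1) S j = t N * (2 ^+ N.+1 - 1).
  rewrite -mulr_sumr; congr (_ * _).
  by rewrite subrX1 [X in _ = X * _](_ : _ = 1) ?mul1r//; ring.
have : t N * (2 ^+ N.+1 - 1) <= 2 * s.
  rewrite mulrBr mulr1 exprS mulrCA /t mulfVK ?gt_eqF ?exprn_gt0//.
  by rewrite lerBlDr lerDl ltW.
move=> /(ler_wpM2l m0); lra.
Qed.

End weak_type_weights.

(** * Marcinkiewicz interpolation *)

(** The two fractions are the constants of the geometric sums over the scales
    below and above the value of the function; the factor [2^p] is the loss made
    by replacing a value by the lower end of its dyadic level.  The constant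
    blows up at both end points [p = 1] and [p = 2]. *)
Definition interpolation_constant (R : realType) (p : R) : R :=
  2 `^ p * (2 `^ (p - 1) / (2 `^ (p - 1) - 1) +
            2 `^ (2 - p) / (2 `^ (2 - p) - 1)).

Lemma interpolation_constant_gt0 (R : realType) (p : R) : 1 < p -> p < 2 ->
  0 < interpolation_constant p.
Proof.
move=> p1 p2; rewrite mulr_gt0 ?powR_gt0// addr_gt0//.
- by rewrite divr_gt0 ?powR_gt0// subr_gt0 powR2_gt1 ?subr_gt0.
- by rewrite divr_gt0 ?powR_gt0// subr_gt0 powR2_gt1 ?subr_gt0.
Qed.

Section marcinkiewicz.
Context d1 d2 (X : measurableType d1) (Y : measurableType d2) (R : realType).
Variables (mu : {measure set X -> \bar R}) (nu : {measure set Y -> \bar R}).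
Variables (u : X -> R) (v w : Y -> R) (A p : R).
Hypotheses (mes_u : measurable_fun setT u) (mv : measurable_fun setT v)
  (mw : measurable_fun setT w).
Hypotheses (u0 : forall x, 0 <= u x) (v0 : forall y, 0 <= v y)
  (w0 : forall y, 0 <= w y) (A0 : 0 <= A) (p1 : 1 < p) (p2 : p < 2).

Let split_at t x := A * (t^-1 * (u x * [ind t < u x]) +
                         t^-1 ^+ 2 * (u x ^+ 2 * [ind u x <= t])).

Let split_at_ge0 t x : 0 < t -> 0 <= split_at t x.
Proof.
move=> t0; rewrite mulr_ge0// addr_ge0//.
  by rewrite mulr_ge0 ?invr_ge0 ?(ltW t0)// mulr_ge0.
by rewrite mulr_ge0 ?sqr_ge0// mulr_ge0 ?sqr_ge0.
Qed.

Let measurable_split_at t : measurable_fun setT (split_at t).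
Proof.
apply: measurable_funM => //; apply: measurable_funD.
- apply: measurable_funM => //; apply: measurable_funM => //.
  by apply: measurable_boolr; exact: measurable_fun_ltr.
- apply: measurable_funM => //; apply: measurable_funM.
    exact: measurable_funX.
  by apply: measurable_boolr; exact: measurable_fun_ler.
Qed.

(** Exchanging the integral over [X] with the sum over the scales leaves, at each
    point [x], a sum of [t_j^(p-1)] over the scales below [u x] and one of
    [t_j^(p-2)] over those above it; multiplied by [u x] and [(u x)^2], both are
    of the order of [(u x)^p]. *)
Let dyadic_split_le t n x : 0 < t ->
  \sum_(j < n) (2 * (t * 2 ^+ j)) `^ p * split_at (t * 2 ^+ j) x <=
  A * interpolation_constant p * u x `^ p.
Proof.
move=> t0.
have S0 j : 0 < t * 2 ^+ j by rewrite mulr_gt0// exprn_gt0.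
have a0 : 0 < p - 1 by rewrite subr_gt0.
have b0 : 0 < 2 - p by rewrite subr_gt0.
have pn0 : p != 0 by rewrite gt_eqF// (lt_trans ltr01).
have -> : \sum_(j < n) (2 * (t * 2 ^+ j)) `^ p * split_at (t * 2 ^+ j) x =
    A * 2 `^ p *
    (u x * \sum_(j < n) (t * 2 ^+ j) `^ (p - 1) * [ind t * 2 ^+ j < u x] +
     u x ^+ 2 *
       \sum_(j < n) (t * 2 ^+ j) `^ (- (2 - p)) * [ind u x <= t * 2 ^+ j]).
  rewrite mulrDr !mulr_sumr -big_split/=; apply: eq_bigr => j _.
  have Sj := S0 j; rewrite /split_at; move: (t * 2 ^+ j) Sj => S Sp.
  have Sn0 : S != 0 by rewrite gt_eqF.
  have E1 : S `^ (p - 1) = S `^ p * S^-1.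
    by rewrite powRB ?powRr1 ?(ltW Sp)//; apply/implyP.
  have E2 : S `^ (- (2 - p)) = S `^ p * S^-1 ^+ 2.
    rewrite opprB powRB; last by apply/implyP.
    by rewrite powR_mulrn ?(ltW Sp)// exprVn.
  by rewrite powRM ?(ltW Sp)// E1 E2; ring.
rewrite /interpolation_constant -2!(mulrA A) ler_wpM2l//.
rewrite -(mulrA (2 `^ p)) ler_wpM2l ?powR_ge0//.
rewrite mulrDl lerD//.
- apply: le_trans (ler_wpM2l (u0 x) (dyadic_sum_below n a0 t0 (u0 x))) _.
  by rewrite -[in leRHS](@mulr_powRB1 _ (u x) p) ?(lt_trans ltr01)// mulrCA.
- have [->|ux] := eqVneq (u x) 0.
    by rewrite expr0n/= mul0r powR0// mulr0.
  have ux0 : 0 < u x by rewrite lt_neqAle eq_sym ux u0.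
  apply: le_trans (ler_wpM2l (sqr_ge0 _) (dyadic_sum_above n b0 t0 ux0)) _.
  rewrite mulrCA ler_wpM2l//.
    by rewrite divr_ge0 ?powR_ge0// subr_ge0 ltW// powR2_gt1.
  rewrite -powR_mulrn// -powRD; last by rewrite ux implybT.
  by rewrite opprB addrCA subrr addr0.
Qed.

(** Here [w] is the density of the target measure, [u] the modulus of the
    function to be transformed and [v] that of its transform.  The hypothesis is
    what weak type (1,1) for the part of [u] above the height [t] and strong type
    (2,2) for the part below it give for the distribution function of [v]. *)
Lemma marcinkiewicz_interpolation :
  (forall t, 0 < t -> (\int[nu]_y (w y * [ind t <= v y])%:E <=
    \int[mu]_x (A * (t^-1 * (u x * [ind t < u x]) +
                     t^-1 ^+ 2 * (u x ^+ 2 * [ind u x <= t])))%:E)%E) ->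
  (\int[nu]_y (v y `^ p * w y)%:E <=
   (A * interpolation_constant p)%:E * \int[mu]_x (u x `^ p)%:E)%E.
Proof.
move=> weak.
have p0 : 0 < p by rewrite (lt_trans ltr01).
have mle t : measurable_fun setT (fun y => t <= v y) by exact: measurable_fun_ler.
have mlt t : measurable_fun setT (fun y => v y < t) by exact: measurable_fun_ltr.
have mvp : measurable_fun setT (fun y => v y `^ p).
  exact: (measurableT_comp (measurable_powR p)).
have mup : measurable_fun setT (fun x => u x `^ p).
  exact: (measurableT_comp (measurable_powR p)).
pose b N y := (2 ^- N <= v y) && (v y < 2 ^+ N).
apply: (integral_le_exhaustion (b := b)).
- by move=> N; exact: measurable_and.
- exact: measurable_funM.
- by move=> y; rewrite mulr_ge0// powR_ge0.
- move=> M N y MN /andP[lo hi]; apply/andP; split.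
    by apply: le_trans lo; rewrite lef_pV2 ?posrE ?exprn_gt0// ler_weXn2l// ler1n.
  by apply: (lt_le_trans hi); rewrite ler_weXn2l// ler1n.
- move=> y vw.
  have vy : 0 < v y.
    rewrite lt_neqAle v0 andbT; apply: contraTN vw => /eqP <-.
    by rewrite powR0 ?gt_eqF// mul0r ltxx.
  have [M vM] := exists_pow2_gt (v y); have [N vN] := exists_pow2_gt (v y)^-1.
  exists (maxn M N); apply/andP; split.
    rewrite -[leRHS]invrK lef_pV2 ?posrE ?exprn_gt0 ?invr_gt0//.
    by rewrite (le_trans (ltW vN))// ler_weXn2l ?ler1n ?leq_maxr.
  by rewrite (lt_le_trans vM)// ler_weXn2l ?ler1n ?leq_maxl.
move=> N; pose t : R := 2 ^- N.
have t0 : 0 < t by rewrite invr_gt0 exprn_gt0.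
pose S j := t * 2 ^+ j.
have S0 j : 0 < S j by rewrite mulr_gt0// exprn_gt0.
have mwS j : measurable_fun setT (fun y => w y * [ind S j <= v y]).
  by apply: measurable_funM => //; exact: measurable_boolr.
have wS0 j y : 0 <= w y * [ind S j <= v y] by rewrite mulr_ge0.
apply: (@le_trans _ _ (\int[nu]_y
    (\sum_(j < N + N) (2 * S j) `^ p * (w y * [ind S j <= v y]))%:E)%E).
  apply: le_integral_real.
  - apply: measurable_funM; first exact: measurable_funM.
    by apply: measurable_boolr; exact: measurable_and.
  - apply: (@measurable_sum_real _ _ R (N + N)
      (fun j y => (2 * S j) `^ p * (w y * [ind S j <= v y]))) => j.
    exact: measurable_funM.
  - by move=> y; rewrite !mulr_ge0 ?powR_ge0.
  - move=> y; rewrite {1}/b; case: (boolP (_ && _)) => [/andP[lo hi]|_]; last first.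
      by rewrite mulr0 sumr_ge0// => j _; rewrite mulr_ge0 ?powR_ge0.
    rewrite mulr1.
    under eq_bigr do rewrite mulrCA mulrC.
    rewrite -mulr_suml ler_wpM2r// powR_le_dyadic_sum ?(ltW p0)//.
    by rewrite exprD mulrA /t mulVf ?mul1r// gt_eqF// exprn_gt0.
rewrite (@integral_sum_real _ _ _ nu (N + N)
    (fun j y => (2 * S j) `^ p * (w y * [ind S j <= v y]))); last 2 first.
- by move=> j; exact: measurable_funM.
- by move=> j y; rewrite mulr_ge0 ?powR_ge0.
apply: (@le_trans _ _ (\sum_(j < N + N)
    \int[mu]_x ((2 * S j) `^ p * split_at (S j) x)%:E)%E).
  apply: lee_sum => j _; rewrite [leLHS]integralZ_real ?powR_ge0//.
  rewrite [leRHS]integralZ_real ?powR_ge0//; last first.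
    by move=> x; exact: split_at_ge0.
  by rewrite lee_wpmul2l ?lee_fin ?powR_ge0// weak.
rewrite -(@integral_sum_real _ _ _ mu (N + N)
    (fun j x => (2 * S j) `^ p * split_at (S j) x)); last 2 first.
- by move=> j; exact: measurable_funM.
- by move=> j x; rewrite mulr_ge0 ?powR_ge0 ?split_at_ge0.
have c0 : 0 <= A * interpolation_constant p.
  by rewrite mulr_ge0// ltW// interpolation_constant_gt0.
rewrite -integralZ_real//; last by move=> x; exact: powR_ge0.
apply: le_integral_real.
- apply: (@measurable_sum_real _ _ R (N + N)
    (fun j x => (2 * S j) `^ p * split_at (S j) x)) => j.
  exact: measurable_funM.
- exact: measurable_funM.
- by move=> x; apply: sumr_ge0 => j _; rewrite mulr_ge0 ?powR_ge0 ?split_at_ge0.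
- by move=> x; exact: dyadic_split_le.
Qed.

End marcinkiewicz.

(** * Complex-valued functions *)

Section complex_valued_functions.
Context d (T : measurableType d) (R : realType).
Variable mu : {measure set T -> \bar R}.
Implicit Types f g : T -> cplx R.

Lemma cabsE (z : cplx R) :
  cabs z = Num.sqrt (complex.Re z ^+ 2 + complex.Im z ^+ 2).
Proof. by case: z. Qed.

Lemma sqr_cabs (z : cplx R) :
  cabs z ^+ 2 = complex.Re z ^+ 2 + complex.Im z ^+ 2.
Proof. by rewrite cabsE sqr_sqrtr// addr_ge0// sqr_ge0. Qed.

Lemma cabs_ge0 (z : cplx R) : 0 <= cabs z.
Proof. by rewrite cabsE sqrtr_ge0. Qed.

Lemma norm_Re_le_cabs (z : cplx R) : `|complex.Re z| <= cabs z.
Proof.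
rewrite -sqrtr_sqr cabsE ler_sqrt ?lerDl ?sqr_ge0// addr_ge0// sqr_ge0//.
Qed.

Lemma norm_Im_le_cabs (z : cplx R) : `|complex.Im z| <= cabs z.
Proof.
rewrite -sqrtr_sqr cabsE ler_sqrt ?lerDr ?sqr_ge0// addr_ge0// sqr_ge0//.
Qed.

Lemma cabsD (z w : cplx R) : cabs (z + w) <= cabs z + cabs w.
Proof. exact: le_normcD. Qed.

Lemma cabsM (z w : cplx R) : cabs (z * w) = cabs z * cabs w.
Proof. exact: Normc.normcM. Qed.

Lemma cabsN (z : cplx R) : cabs (- z) = cabs z.
Proof. exact: normcN. Qed.

Lemma cabs_conj (z : cplx R) : cabs (z^*)%C = cabs z.
Proof. by case: z => a b; rewrite !cabsE/= sqrrN. Qed.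

Lemma measurable_cabs f : cmeasurable f ->
  measurable_fun setT (fun x => cabs (f x)).
Proof.
move=> [mr mi]; under eq_fun do rewrite cabsE.
apply: (@measurableT_comp _ _ _ _ _ _ (@Num.sqrt R)).
  by apply: continuous_measurable_fun; exact: sqrt_continuous.
by apply: measurable_funD; exact: measurable_funX.
Qed.

Lemma measurable_cabs_powR (r : R) f : cmeasurable f ->
  measurable_fun setT (fun x => cabs (f x) `^ r).
Proof.
move=> mf; apply: (measurableT_comp (measurable_powR r)).
exact: measurable_cabs.
Qed.

Lemma cmeasurableD f g : cmeasurable f -> cmeasurable g ->
  cmeasurable (fun x => f x + g x).
Proof.
move=> [fr fi] [gr gi]; split.
- rewrite (_ : (fun x => _) =
    (fun x => complex.Re (f x)) \+ (fun x => complex.Re (g x))).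
    exact: measurable_funD.
  by apply/funext => x /=; case: (f x) (g x) => [? ?] [].
- rewrite (_ : (fun x => _) =
    (fun x => complex.Im (f x)) \+ (fun x => complex.Im (g x))).
    exact: measurable_funD.
  by apply/funext => x /=; case: (f x) (g x) => [? ?] [].
Qed.

Lemma cmeasurableN f : cmeasurable f -> cmeasurable (fun x => - f x).
Proof.
move=> [fr fi]; split.
- rewrite (_ : (fun x => _) = \- (fun x => complex.Re (f x))).
    exact: measurable_funN.
  by apply/funext => x /=; case: (f x).
- rewrite (_ : (fun x => _) = \- (fun x => complex.Im (f x))).
    exact: measurable_funN.
  by apply/funext => x /=; case: (f x).
Qed.

Lemma cmeasurableB f g : cmeasurable f -> cmeasurable g ->
  cmeasurable (fun x => f x - g x).
Proof. by move=> mf mg; apply: cmeasurableD => //; exact: cmeasurableN. Qed.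

Lemma cmeasurableM f g : cmeasurable f -> cmeasurable g ->
  cmeasurable (fun x => f x * g x).
Proof.
move=> [fr fi] [gr gi]; split.
- rewrite (_ : (fun x => _) =
    ((fun x => complex.Re (f x)) \* (fun x => complex.Re (g x))) \-
    ((fun x => complex.Im (f x)) \* (fun x => complex.Im (g x)))).
    by apply: measurable_funB; exact: measurable_funM.
  by apply/funext => x /=; case: (f x) (g x) => [? ?] [].
- rewrite (_ : (fun x => _) =
    ((fun x => complex.Re (f x)) \* (fun x => complex.Im (g x))) \+
    ((fun x => complex.Im (f x)) \* (fun x => complex.Re (g x)))).
    by apply: measurable_funD; exact: measurable_funM.
  by apply/funext => x /=; case: (f x) (g x) => [? ?] [].
Qed.

Lemma cmeasurable_conj f : cmeasurable f -> cmeasurable (fun x => (f x)^*)%C.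
Proof.
move=> [fr fi]; split.
- rewrite (_ : (fun x => _) = (fun x => complex.Re (f x)))//.
  by apply/funext => x /=; case: (f x).
- rewrite (_ : (fun x => _) = \- (fun x => complex.Im (f x))).
    exact: measurable_funN.
  by apply/funext => x /=; case: (f x).
Qed.

Lemma cmeasurable_ind (b : T -> bool) f : measurable_fun setT b ->
  cmeasurable f -> cmeasurable (fun x => f x * [ind b x]).
Proof.
move=> mb mf; apply: cmeasurableM => //; split.
- rewrite (_ : (fun x => _) = (fun x => [ind b x])); first exact: measurable_boolr.
  by apply/funext => x; case: (b x).
- rewrite (_ : (fun x => _) = (fun=> 0)); first exact: measurable_cst.
  by apply/funext => x; case: (b x).
Qed.

Definition cintegrable f :=
  cmeasurable f /\ (\int[mu]_x (cabs (f x))%:E < +oo)%E.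

Lemma cintegrable_Re f : cintegrable f ->
  mu.-integrable setT (EFin \o (fun x => complex.Re (f x))).
Proof.
move=> [mf foo]; apply/integrableP; split.
  by apply/measurable_EFinP; have [] := mf.
apply: le_lt_trans foo; apply: le_integral_real.
- by apply: measurableT_comp => //; have [] := mf.
- exact: measurable_cabs.
- by move=> x; exact: normr_ge0.
- by move=> x; exact: norm_Re_le_cabs.
Qed.

Lemma cintegrable_Im f : cintegrable f ->
  mu.-integrable setT (EFin \o (fun x => complex.Im (f x))).
Proof.
move=> [mf foo]; apply/integrableP; split.
  by apply/measurable_EFinP; have [] := mf.
apply: le_lt_trans foo; apply: le_integral_real.
- by apply: measurableT_comp => //; have [] := mf.
- exact: measurable_cabs.
- by move=> x; exact: normr_ge0.
- by move=> x; exact: norm_Im_le_cabs.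
Qed.

Lemma cintegrableD f g : cintegrable f -> cintegrable g ->
  cintegrable (fun x => f x + g x).
Proof.
move=> [mf fo] [mg go]; have mfg := cmeasurableD mf mg; split => //.
apply: (@le_lt_trans _ _ (\int[mu]_x (cabs (f x) + cabs (g x))%:E)%E).
  apply: le_integral_real.
  - exact: measurable_cabs.
  - by apply: measurable_funD; exact: measurable_cabs.
  - by move=> x; exact: cabs_ge0.
  - by move=> x; exact: cabsD.
rewrite integralD_real; try by [exact: measurable_cabs|move=> x; exact: cabs_ge0].
exact: lte_add_pinfty.
Qed.

Lemma cintegrableN f : cintegrable f -> cintegrable (fun x => - f x).
Proof.
move=> [mf fo]; split; first exact: cmeasurableN.
by under eq_integral do rewrite cabsN.
Qed.

Lemma cintegralD f g : cintegrable f -> cintegrable g ->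
  cintegral mu (fun x => f x + g x) = cintegral mu f + cintegral mu g.
Proof.
move=> fi gi; rewrite /cintegral.
transitivity ((\int[mu]_x (complex.Re (f x) + complex.Re (g x))) +i*
              (\int[mu]_x (complex.Im (f x) + complex.Im (g x))))%C.
  by congr (_ +i* _)%C; apply: eq_Rintegral => x _; case: (f x) (g x) => [? ?] [].
by rewrite !RintegralD//; (exact: cintegrable_Re || exact: cintegrable_Im).
Qed.

Lemma cintegralN f : cintegrable f ->
  cintegral mu (fun x => - f x) = - cintegral mu f.
Proof.
move=> fi; have := cintegralD fi (cintegrableN fi).
rewrite (_ : (fun x => f x - f x) = cst 0); last first.
  by apply/funext => x; rewrite subrr.
rewrite {1}/cintegral !Rintegral_cst//= mul0r => /esym/eqP.
by rewrite addrC addr_eq0 => /eqP.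
Qed.

(** With [I] the integral of [f] and [(a, b)] its coordinates, [|I|^2] is the
    integral of [a Re f + b Im f], which is at most [|I| |f|] pointwise. *)
Lemma cabs_cintegral_le f : cintegrable f ->
  ((cabs (cintegral mu f))%:E <= \int[mu]_x (cabs (f x))%:E)%E.
Proof.
move=> fi; have [mf foo] := fi.
set I := cintegral mu f; pose a := complex.Re I; pose b := complex.Im I.
have [->|I0] := eqVneq (cabs I) 0.
  by apply: integral_ge0 => x _; rewrite lee_fin cabs_ge0.
have ci : mu.-integrable setT (EFin \o (fun x => cabs (f x))).
  apply/integrableP; split; first exact/measurable_EFinP/measurable_cabs.
  by under eq_integral do rewrite /= ger0_norm ?cabs_ge0//.
have ri := cintegrable_Re fi; have ii := cintegrable_Im fi.
have -> : (\int[mu]_x (cabs (f x))%:E = (\int[mu]_x cabs (f x))%:E)%E.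
  by rewrite fineK//; exact: integrable_fin_num.
rewrite lee_fin -(ler_pM2l (x := cabs I)); last first.
  by rewrite lt_neqAle eq_sym I0 cabs_ge0.
have Zi (k : R) (g : T -> R) : mu.-integrable setT (EFin \o g) ->
    mu.-integrable setT (EFin \o (fun x => k * g x)).
  move=> gi; rewrite (_ : EFin \o _ = (fun x => k%:E * (g x)%:E)%E).
    exact: integrableZl.
  by apply/funext => x; rewrite /= EFinM.
have -> : cabs I * cabs I =
    a * (\int[mu]_x complex.Re (f x)) + b * (\int[mu]_x complex.Im (f x)).
  by rewrite -expr2 sqr_cabs !expr2.
rewrite -!RintegralZl// -RintegralD//; [|exact: Zi..].
apply: le_Rintegral => //.
- rewrite (_ : EFin \o _ =
    (fun x => (a * complex.Re (f x))%:E + (b * complex.Im (f x))%:E)%E).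
    by apply: integrableD => //; exact: Zi.
  by apply/funext => x; rewrite /= EFinD.
- exact: Zi.
move=> x _; rewrite (le_trans (ler_norm _))//.
rewrite -sqrtr_sqr !cabsE -sqrtrM ?addr_ge0 ?sqr_ge0//.
rewrite ler_sqrt ?mulr_ge0 ?addr_ge0 ?sqr_ge0//.
(* What remains is the Cauchy-Schwarz inequality in the plane. *)
rewrite -subr_ge0.
suff <- : (a * complex.Im (f x) - b * complex.Re (f x)) ^+ 2 =
    (complex.Re I ^+ 2 + complex.Im I ^+ 2) *
      (complex.Re (f x) ^+ 2 + complex.Im (f x) ^+ 2) -
    (a * complex.Re (f x) + b * complex.Im (f x)) ^+ 2 by exact: sqr_ge0.
by rewrite -/a -/b; ring.
Qed.

Lemma cLnormE (p : R) f :
  cLnorm mu p%:E f = ((\int[mu]_x (cabs (f x) `^ p)%:E) `^ p^-1)%E.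
Proof.
rewrite /cLnorm unlock; congr (_ `^ _)%E.
by apply: eq_integral => x _; rewrite /= ger0_norm// cabs_ge0.
Qed.

Lemma cLpP (p : R) f : 0 < p ->
  cLp mu p%:E f <->
  cmeasurable f /\ (\int[mu]_x (cabs (f x) `^ p)%:E < +oo)%E.
Proof.
move=> p0; rewrite /cLp/= cLnormE; split => -[mf foo]; split => //.
- by apply: lty_poweRy foo; rewrite invr_neq0// gt_eqF.
- exact: poweR_lty.
Qed.

End complex_valued_functions.

(** * Integrals against nonnegative complex measures *)

Section positive_complex_measures.
Context d (T : measurableType d) (R : realType).

Lemma Rintegral_zero_measure (m : {measure set T -> \bar R}) (f : T -> R) :
  (forall A, measurable A -> m A = 0%E) -> \int[m]_x f x = 0.
Proof.
move=> m0; rewrite /Rintegral (eq_measure_integral mzero).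
  by rewrite integral_measure_zero.
by move=> A mA _; rewrite m0.
Qed.

(** The negative part of the Jordan decomposition of a nonnegative charge
    vanishes, whichever Hahn decomposition is chosen. *)
Lemma ge0_charge_integralE (nu : {charge set T -> \bar R}) :
  (forall A, measurable A -> (0 <= nu A)%E) ->
  exists2 m : {measure set T -> \bar R},
    (forall A, measurable A -> m A = nu A) &
    (forall f, charge_integral nu f = \int[m]_x f x).
Proof.
move=> nu0; rewrite /charge_integral.
cbv zeta; move: (sval (cid (svalP (cid (Hahn_decomposition nu)))))
  (svalP (cid (svalP (cid (Hahn_decomposition nu))))) => N PN.
have neg0 A : measurable A -> jordan_neg PN A = 0%E.
  move=> mA; rewrite jordan_negE cjordan_negE /crestr0 mem_set// /crestr/=.
  have [_ [mN negN] _ _] := PN.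
  have mAN : measurable (A `&` N) by exact: measurableI.
  by apply/eqP; rewrite oppe_eq0 eq_le nu0// negN// => x [].
exists (jordan_pos PN).
  move=> A mA; rewrite (jordan_decomp PN mA) /cadd/= cscaleN1.
  by rewrite [X in (_ - X)%E]neg0// sube0.
by move=> f; rewrite [X in _ - X]Rintegral_zero_measure// subr0.
Qed.

(** A nonnegative complex measure of mass 1 has zero imaginary part, and its real
    part integrates like a probability measure. *)
Lemma cabs_cm_integral_le (nu : cmeasure T R) (f : T -> cplx R) (M : R) :
  cm_ge0 nu -> nu setT = 1 -> cmeasurable f -> (forall x, cabs (f x) <= M) ->
  cabs (cm_integral nu f) <= M.
Proof.
move=> nu0 nu1 mf fM.
have re0 A : measurable A -> (0 <= re_charge nu A)%E.
  move=> mA; have := nu0 A mA; rewrite lecE/= => /andP[_].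
  by rewrite -lee_fin fineK// fin_num_measure.
have im0 A : measurable A -> im_charge nu A = 0%E.
  move=> mA; have := nu0 A mA; rewrite lecE/= => /andP[/eqP im0 _].
  by rewrite -[LHS]fineK ?fin_num_measure// im0.
have [m mE intE] := ge0_charge_integralE re0.
have [|k kE iintE] := @ge0_charge_integralE (im_charge nu).
  by move=> A mA; rewrite im0.
have k0 A : measurable A -> k A = 0%E by move=> mA; rewrite kE// im0.
have m1 : m setT = 1%E.
  rewrite mE// -[LHS]fineK ?fin_num_measure//.
  by have := congr1 (@complex.Re R) nu1 => /= ->.
have -> : cm_integral nu f = cintegral m f.
  rewrite /cm_integral !intE !iintE !(Rintegral_zero_measure _ k0).
  by rewrite subr0 addr0.
have M0 : 0 <= M by exact: le_trans (cabs_ge0 _) (fM point).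
have fle : (\int[m]_x (cabs (f x))%:E <= M%:E)%E.
  apply: (@le_trans _ _ (\int[m]_x M%:E)%E).
    apply: le_integral_real => //; first exact: measurable_cabs.
    by move=> x; exact: cabs_ge0.
  by rewrite integral_cst// m1 mule1.
rewrite -lee_fin; apply: (le_trans _ fle); apply: cabs_cintegral_le; split => //.
by rewrite (le_lt_trans fle)// ltry.
Qed.

End positive_complex_measures.

(** * Continuous functions and characters *)

Section borel_functions.
Context (T : ptopologicalType) (R : realType).

Lemma open_borel (U : set T) : open U -> measurable (U : set (borel T)).
Proof. by move=> oU; exact: sub_sigma_algebra. Qed.

Lemma continuous_borel_measurable (f : T -> R) : continuous f ->
  measurable_fun [set: borel T] f.
Proof.
move=> /continuousP cf; apply: (measurability _ (RGenOpens.measurableE R)) => //.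
move=> _ [_ [a [b ->] <-]]; rewrite setTI; apply: open_borel; apply: cf.
exact: interval_open.
Qed.

(** Continuity of complex-valued functions is handled through the real number
    [cabs (f y - f x)]; the norm of [R[i]] takes its values in [R[i]]. *)
Lemma dist_Re_Im_continuous (f : T -> cplx R) :
  (forall x (e : R), 0 < e -> \forall y \near x, cabs (f y - f x) <= e) ->
  continuous (fun x => complex.Re (f x)) /\
  continuous (fun x => complex.Im (f x)).
Proof.
move=> cf; split => x; apply/cvgrPdist_le => e e0; near=> y.
- rewrite distrC; have : cabs (f y - f x) <= e by near: y; exact: cf.
  apply: le_trans; apply: le_trans (norm_Re_le_cabs _).
  by case: (f y) (f x) => [? ?] [].
- rewrite distrC; have : cabs (f y - f x) <= e by near: y; exact: cf.
  apply: le_trans; apply: le_trans (norm_Im_le_cabs _).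
  by case: (f y) (f x) => [? ?] [].
Unshelve. all: by end_near. Qed.

Lemma dist_continuous_cmeasurable (f : T -> cplx R) :
  (forall x (e : R), 0 < e -> \forall y \near x, cabs (f y - f x) <= e) ->
  @cmeasurable _ (borel T) R f.
Proof.
by move=> /dist_Re_Im_continuous[cr ci]; split; exact: continuous_borel_measurable.
Qed.

Lemma continuous_dist (f : T -> cplx R) : continuous f ->
  forall x (e : R), 0 < e -> \forall y \near x, cabs (f y - f x) <= e.
Proof.
move=> cf x e e0.
have ec0 : 0 < (e%:C)%C :> cplx R by rewrite (ltcR 0).
have /cvgrPdist_le/(_ _ ec0) := cf x; apply: filterS => y.
by rewrite distrC -lecR.
Qed.

End borel_functions.

Section characters.
Context (R : realType) (H : hypergroup R).
Implicit Types chi : hg_dual H.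

Lemma character_continuous chi : continuous (character_fun chi).
Proof. by have /set_mem[] := valP chi. Qed.

Lemma character_cmeasurable chi : @cmeasurable _ (borel H) R (character_fun chi).
Proof.
apply: dist_continuous_cmeasurable; apply: continuous_dist.
exact: character_continuous.
Qed.

(** If [s] is the supremum of [|chi|], then [|chi x| |chi y|], which is
    [|chi (x * y)|], is at most [s] because [x * y] is averaged over a probability
    measure.  The supremum over [y] gives [|chi x| s <= s]. *)
Lemma cabs_character_le1 chi x : cabs (character_fun chi x) <= 1.
Proof.
have /set_mem[_ [M chiM] [z chiz] _ chiX] := valP chi.
pose s := sup (range (fun y => cabs (character_fun chi y))).
have ub : has_sup (range (fun y => cabs (character_fun chi y))).
  split; first by exists (cabs (character_fun chi x)), x.
  by exists M => _ [y _ <-]; exact: chiM.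
have le_s y : cabs (character_fun chi y) <= s.
  by apply: (sup_upper_bound ub); exists y.
have s0 : 0 < s.
  apply: lt_le_trans (le_s z); rewrite lt_neqAle cabs_ge0 andbT eq_sym.
  by apply: contra chiz => /eqP h; apply/eqP; exact: Normc.eq0_normc h.
have [->|cx0] := eqVneq (cabs (character_fun chi x)) 0; first exact: ler01.
have cx : 0 < cabs (character_fun chi x) by rewrite lt_neqAle eq_sym cx0 cabs_ge0.
suff : s <= s / cabs (character_fun chi x).
  by rewrite ler_pdivlMr// ger_pMr.
apply: sup_le_ub; first by case: ub.
move=> _ [y _ <-]; rewrite ler_pdivlMr// mulrC -cabsM.
rewrite -chiX /translate; apply: cabs_cm_integral_le.
- exact: conv_dirac_ge0.
- exact: conv_dirac_setT.
- exact: character_cmeasurable.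
- exact: le_s.
Qed.

End characters.

Lemma exists_nat_between (R : realType) (r : R) : 0 < r ->
  exists n, (n.+1%:R^-1 <= r) && (r <= n.+1%:R).
Proof.
move=> r0; have rV : 0 < r^-1 by rewrite invr_gt0.
exists (Num.bound (r + r^-1)).
have := archi_boundP (ltW (addr_gt0 r0 rV)).
move: (Num.bound _) => N; rewrite -natr1 => rN.
have N0 : 0 < N%:R + 1 :> R by rewrite ltr_wpDl.
rewrite -[X in _ <= X]invrK lef_pV2 ?posrE ?invr_gt0//.
by apply/andP; split; lra.
Qed.

(** * Tightness of integrals against a Radon measure *)

Section radon_tightness.
Context (R : realType) (H : hypergroup R).
Variable la : {measure set (borel H) -> \bar R}.
Hypothesis la_radon : radon_measure la.

Lemma compact_borel (K : set H) : compact K -> measurable (K : set (borel H)).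
Proof.
move=> cK; rewrite -[X in measurable X]setCK; apply: measurableC.
apply: open_borel; apply: closed_openC; apply: compact_closed cK.
exact: (@lch_hausdorff H).
Qed.

(** Up to a small error the integral lives on a set [A] where [u] lies between two
    positive constants.  There [u] is bounded and [A] has finite measure, so [A]
    lies in an open set of finite measure, which a compact set fills up to a
    set of small measure. *)
Lemma radon_integral_tight (u : H -> R) (e : R) :
  measurable_fun [set: borel H] u -> (forall x, 0 <= u x) ->
  (\int[la]_x (u x)%:E < +oo)%E -> 0 < e ->
  exists2 K : set H, compact K &
    (\int[la]_x (u x * \1_(~` K) x)%:E <= e%:E)%E.
Proof.
move=> mes_u u0 uoo e0; have [_ outer inner] := la_radon.
have e20 : 0 < e / 2 by rewrite divr_gt0.
pose b n (x : borel H) := (n.+1%:R^-1 <= u x) && (u x <= n.+1%:R).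
have mb n : measurable_fun [set: borel H] (b n).
  by apply: measurable_and; exact: measurable_fun_ler.
have mub n : measurable_fun [set: borel H] (fun x => u x * [ind b n x]).
  by apply: measurable_funM => //; exact: measurable_boolr.
have munb n : measurable_fun [set: borel H] (fun x => u x * [ind ~~ b n x]).
  apply: measurable_funM => //; apply: measurable_boolr.
  exact: measurable_neg.
have ub0 (c : bool) x : 0 <= u x * [ind c] by rewrite mulr_ge0.
have split_b n : (\int[la]_x (u x)%:E =
    \int[la]_x (u x * [ind b n x])%:E + \int[la]_x (u x * [ind ~~ b n x])%:E)%E.
  rewrite -integralD_real//; apply: eq_integral => x _.
  by case: (b n x); rewrite /= mulr1 mulr0 ?addr0 ?add0r.
have [n tail_n] : exists n, (\int[la]_x (u x * [ind ~~ b n x])%:E <= (e / 2)%:E)%E.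
  apply: contrapT => /forallNP tail.
  suff : (\int[la]_x (u x)%:E <= \int[la]_x (u x)%:E - (e / 2)%:E)%E.
    have : (\int[la]_x (u x)%:E)%E \is a fin_num.
      by rewrite ge0_fin_numE//; apply: integral_ge0 => x _; rewrite lee_fin.
    move: (\int[la]_x (u x)%:E)%E => [r| |]//= _.
    by rewrite lee_fin; lra.
  apply: (integral_le_exhaustion (b := b)) => //.
  - move=> m k x mk /andP[lo hi]; apply/andP; split.
      by apply: le_trans lo; rewrite lef_pV2 ?posrE ?ltr0n// ler_nat ltnS.
    by apply: le_trans hi _; rewrite ler_nat ltnS.
  - by move=> x ux; exact: exists_nat_between.
  - move=> n; have /negP := tail n; rewrite -ltNge => tn.
    rewrite leeBrDr// (split_b n) leeD2l//; exact: ltW.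
pose A : set (borel H) := [set x | b n x].
have mA : measurable A.
  by rewrite -[X in measurable X]setTI; exact: (mb n measurableT [set true]).
have n0 : 0 < n.+1%:R :> R by rewrite ltr0n.
have la_A : (la A < +oo)%E.
  have : ((n.+1%:R^-1)%:E * la A <= \int[la]_x (u x)%:E)%E.
    rewrite -integral_cst// integral_mkcond.
    rewrite (eq_integral (fun x => (n.+1%:R^-1 * \1_A x)%:E)); last first.
      move=> x _; rewrite patchE indicE.
      by case: ifPn => _ /=; rewrite ?mulr1 ?mulr0.
    apply: le_integral_real => //.
    - by apply: measurable_funM => //; exact: measurable_indic.
    - move=> x; rewrite indicE; case: (boolP (x \in A)); rewrite ?mulr0 ?mulr1//.
      by rewrite inE => /andP[].
  move=> /le_lt_trans/(_ uoo); case: (la A) => [r|//|]; rewrite ?ltry//.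
  by rewrite gt0_muley ?ltxx// lte_fin invr_gt0.
have [U [oU AU Uoo]] : exists U : set H, [/\ open U, A `<=` U & (la U < +oo)%E].
  move: la_A; rewrite (outer A mA) => /ereal_inf_lt[_ [U [oU AU] <-] Uoo].
  by exists U.
pose dl := e / 2 / n.+1%:R.
have dl0 : 0 < dl by rewrite divr_gt0.
have laU : la U \is a fin_num by rewrite ge0_fin_numE.
have [K [cK KU laK]] : exists K : set H,
    [/\ compact K, K `<=` U & (la U - dl%:E < la K)%E].
  have : (la U - dl%:E < la U)%E by rewrite lteBlDr// lteDl ?lte_fin.
  rewrite {2}(inner U oU) => /ereal_sup_gt[_ [K [cK KU] <-] laK].
  by exists K.
exists K => //.
have mK := compact_borel cK; have mU := open_borel oU.
have laAK : (la (A `\` K) <= dl%:E)%E.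
  apply: (@le_trans _ _ (la (U `\` K))).
    apply: le_measure; rewrite ?inE; [exact: measurableD..|].
    by apply: setSD.
  have laKfin : la K \is a fin_num.
    rewrite ge0_fin_numE//; apply: le_lt_trans Uoo.
    by apply: le_measure; rewrite ?inE.
  rewrite measureD//= (setIidr KU) leeBlDl//.
  by move: laK; rewrite lteBlDr// => /ltW.
have mAK : measurable (A `\` K) by exact: measurableD.
apply: (@le_trans _ _ (\int[la]_x
    (u x * [ind ~~ b n x] + n.+1%:R * \1_(A `\` K) x)%:E)%E).
  apply: le_integral_real.
  - by apply: measurable_funM => //; apply: measurable_indic; exact: measurableC.
  - apply: measurable_funD; first exact: munb.
    by apply: measurable_funM => //; exact: measurable_indic.
  - by move=> x; rewrite mulr_ge0.
  - move=> x; case: (boolP (b n x)) => bx /=; last first.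
      by rewrite mulr1 ler_wpDr ?mulr_ge0// ler_piMr// indicE.
    rewrite mulr0 add0r; have [Kx|nKx] := pselect (K x).
      by rewrite !indicE [x \in ~` K]memNset ?mulr0 ?mulr_ge0//; exact.
    rewrite !indicE !mem_set ?mulr1//; first by have /andP[] := bx.
rewrite integralD_real//; last first.
  by apply: measurable_funM => //; exact: measurable_indic.
rewrite [X in (_ + X <= _)%E]integralZ_real//.
rewrite integral_indic// setIT.
have -> : (e%:E = (e / 2)%:E + n.+1%:R%:E * dl%:E)%E.
  rewrite -EFinM -EFinD /dl [_ * (_ / _)]mulrC divfK ?gt_eqF//; congr EFin; lra.
by rewrite leeD// lee_wpmul2l// lee_fin.
Qed.

End radon_tightness.

(** * The Fourier transform of integrable functions *)

Section fourier_transform.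
Context (R : realType) (H : hypergroup R).
Variable la : {measure set (borel H) -> \bar R}.
Implicit Types (chi : hg_dual H) (f g : H -> cplx R).

Lemma cintegrable_mul_character f chi : cintegrable la f ->
  cintegrable la (fun x => f x * (character_fun chi x)^*)%C.
Proof.
move=> [mf foo]; split.
  by apply: cmeasurableM => //; apply: cmeasurable_conj; exact: character_cmeasurable.
apply: le_lt_trans foo; apply: le_integral_real.
- apply: measurable_cabs; apply: cmeasurableM => //.
  by apply: cmeasurable_conj; exact: character_cmeasurable.
- exact: measurable_cabs.
- by move=> x; exact: cabs_ge0.
- move=> x; rewrite cabsM cabs_conj ler_piMr ?cabs_ge0//.
  exact: cabs_character_le1.
Qed.

Lemma fourierD f g chi : cintegrable la f -> cintegrable la g ->
  fourier la (fun x => f x + g x) chi = fourier la f chi + fourier la g chi.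
Proof.
move=> fi gi; rewrite /fourier -cintegralD; try exact: cintegrable_mul_character.
by congr cintegral; apply/funext => x; rewrite mulrDl.
Qed.

Lemma cabs_fourier_le f chi : cintegrable la f ->
  ((cabs (fourier la f chi))%:E <= \int[la]_x (cabs (f x))%:E)%E.
Proof.
move=> fi; have [mf _] := fi.
have fci := cintegrable_mul_character chi fi.
apply: le_trans (cabs_cintegral_le fci) _; have [mfc _] := fci.
apply: le_integral_real => //.
- exact: measurable_cabs.
- exact: measurable_cabs.
- by move=> x; exact: cabs_ge0.
- move=> x; rewrite cabsM cabs_conj ler_piMr ?cabs_ge0//.
  exact: cabs_character_le1.
Qed.

Lemma cabs_fourier_sub_le f chi chi' : cintegrable la f ->
  ((cabs (fourier la f chi - fourier la f chi'))%:E <=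
   \int[la]_x (cabs (f x) * cabs (character_fun chi x - character_fun chi' x))%:E)%E.
Proof.
move=> fi; have ci := cintegrable_mul_character chi fi.
have ci' := cintegrable_mul_character chi' fi.
have di := cintegrableD ci (cintegrableN ci').
rewrite /fourier -cintegralN// -cintegralD//; last exact: cintegrableN.
apply: le_trans (cabs_cintegral_le di) _.
rewrite le_eqVlt; apply/orP; left; apply/eqP; apply: eq_integral => x _.
by rewrite -mulrBr -rmorphB cabsM cabs_conj.
Qed.

(** Near a continuous function the compact-open topology is that of uniform
    convergence on compact sets. *)
Lemma character_near_compact chi (K : set H) (e : R) : compact K -> 0 < e ->
  \forall chi' \near chi,
    forall x, K x -> cabs (character_fun chi' x - character_fun chi x) <= e.
Proof.
move=> cK e0.
have cvgK : {family compact,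
    nbhs (character_fun chi : {compact-open, H -> cplx R}) --> character_fun chi}.
  apply/compact_open_fam_compactP; first exact: character_continuous.
  exact: cvg_id.
have ec0 : 0 < (e%:C)%C :> cplx R by rewrite (ltcR 0).
have near_fun : nbhs (character_fun chi : {compact-open, H -> cplx R})
    [set g : H -> cplx R | forall x, K x -> cabs (g x - character_fun chi x) <= e].
  move/fam_cvgP : cvgK => /(_ K cK); apply; apply/uniform_nbhs.
  exists [set xy | ball xy.1 (e%:C)%C xy.2]; split.
    exact: (entourage_ball _ (PosNum ec0)).
  move=> g gK x Kx; have := gK x Kx; rewrite /= /ball/= => /ltW.
  by rewrite distrC -lecR.
exact: (@initial_continuous (hg_dual H) _
  (set_val : hg_dual H -> {compact-open, H -> cplx R}) chi _ near_fun).
Qed.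

(** The transform is continuous.  The difference of its values at two characters
    is at most the integral of [|f|] times their distance, which is uniformly
    small on a compact set that carries all but a small part of the integral of
    [|f|], and at most [2] elsewhere. *)
Lemma fourier_cmeasurable f : radon_measure la -> cintegrable la f ->
  @cmeasurable _ (borel (hg_dual H)) R (fourier la f).
Proof.
move=> laR fi; have [mf foo] := fi.
apply: dist_continuous_cmeasurable => chi e e0.
have mcf := measurable_cabs mf.
have [K cK Kf] := radon_integral_tight laR mcf (fun x => cabs_ge0 (f x)) foo
  (divr_gt0 e0 (ltr0n R 4)).
pose J := fine (\int[la]_x (cabs (f x))%:E)%E.
have J0 : 0 <= J.
  by rewrite fine_ge0//; apply: integral_ge0 => x _; rewrite lee_fin cabs_ge0.
have JE : (\int[la]_x (cabs (f x))%:E = J%:E)%E.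
  rewrite fineK// ge0_fin_numE//; apply: integral_ge0 => x _.
  by rewrite lee_fin cabs_ge0.
pose dl := e / 2 / (J + 1).
have dl0 : 0 < dl by rewrite !divr_gt0// ltr_wpDl.
apply: filterS (character_near_compact chi cK dl0) => chi' chiK.
have mK := compact_borel cK.
rewrite -lee_fin; apply: le_trans (cabs_fourier_sub_le chi' chi fi) _.
have mcd : measurable_fun [set: borel H]
    (fun x => cabs (character_fun chi' x - character_fun chi x)).
  by apply: measurable_cabs; apply: cmeasurableB; exact: character_cmeasurable.
have mI : measurable_fun [set: borel H] (\1_(~` K) : borel H -> R).
  by apply: measurable_indic; exact: measurableC.
apply: (@le_trans _ _ (\int[la]_x
    (dl * cabs (f x) + 2 * (cabs (f x) * \1_(~` K) x))%:E)%E).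
  apply: le_integral_real.
  - exact: measurable_funM.
  - apply: measurable_funD; first exact: measurable_funM.
    by apply: measurable_funM => //; exact: measurable_funM.
  - by move=> x; rewrite mulr_ge0 ?cabs_ge0.
  - move=> x; have f0 := cabs_ge0 (f x); rewrite indicE.
    have [Kx|nKx] := pselect (K x).
      rewrite memNset ?mulr0 ?addr0; last exact.
      by rewrite mulrC ler_wpM2r// chiK.
    rewrite mem_set// mulr1 ler_wpDl//; first by rewrite mulr_ge0// ltW.
    rewrite mulrC ler_wpM2r//.
    apply: le_trans (cabsD _ _) _; rewrite cabsN.
    have := cabs_character_le1 chi x; have := cabs_character_le1 chi' x; lra.
have mfI : measurable_fun [set: borel H] (fun x => cabs (f x) * \1_(~` K) x).
  exact: measurable_funM.
rewrite integralD_real; last 4 first.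
- exact: measurable_funM.
- exact: measurable_funM.
- by move=> x; rewrite mulr_ge0 ?cabs_ge0 ?ltW.
- by move=> x; rewrite !mulr_ge0 ?cabs_ge0.
rewrite !integralZ_real ?(ltW dl0)//; last 2 first.
- by move=> x; rewrite mulr_ge0 ?cabs_ge0.
- by move=> x; rewrite cabs_ge0.
rewrite JE; apply: (@le_trans _ _ ((dl * J)%:E + 2%:E * (e / 4)%:E)%E).
  by rewrite EFinM leeD2l// lee_wpmul2l// lee_fin.
rewrite -EFinM -EFinD lee_fin.
have : dl * J <= e / 2.
  by rewrite /dl mulrAC ler_pdivrMr ?ltr_wpDl// ler_pM2l ?divr_gt0// lerDl.
lra.
Qed.

End fourier_transform.

(** * The inequality for functions in both L^1 and L^2 *)

Section paley_inequality.
Context (R : realType) (H : hypergroup R).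
Variables (la : {measure set (borel H) -> \bar R})
  (pi : {measure set (borel (hg_dual H)) -> \bar R}).
Hypotheses (la_radon : radon_measure la) (la_pi : plancherel_measure la pi).

Definition square_cintegrable (h : H -> cplx R) :=
  (\int[la]_x (cabs (h x) ^+ 2)%:E < +oo)%E.

Lemma cLp1P (h : H -> cplx R) : cLp la 1%:E h <-> cintegrable la h.
Proof.
rewrite (cLpP la h ltr01) /cintegrable.
by under eq_integral do rewrite powRr1 ?cabs_ge0//.
Qed.

Lemma cLp2P (h : H -> cplx R) :
  cLp la 2%:E h <-> @cmeasurable _ (borel H) R h /\ square_cintegrable h.
Proof.
rewrite (cLpP la h (ltr0n R 2)) /square_cintegrable.
by under eq_integral do rewrite powR_mulrn ?cabs_ge0//.
Qed.

Lemma plancherel h : cintegrable la h -> square_cintegrable h ->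
  (\int[pi]_chi (cabs (fourier la h chi) ^+ 2)%:E =
   \int[la]_x (cabs (h x) ^+ 2)%:E)%E.
Proof.
move=> h1 h2; have [mh _] := h1.
by rewrite la_pi//; [exact/cLp1P|exact/cLp2P].
Qed.

Lemma cabs_ind (z : cplx R) (b : bool) : cabs (z * [ind b]) = cabs z * [ind b].
Proof. by case: b; rewrite ?mulr1// !mulr0 Normc.normc0. Qed.

Section weak_type.
Variables (psi : hg_dual H -> R) (m : R).
Hypotheses (mpsi : measurable_fun [set: borel (hg_dual H)] psi)
  (psi0 : forall chi, 0 < psi chi) (m0 : 0 < m).
Hypothesis weak_psi : forall t, 0 < t ->
  (t%:E * pi [set chi | (t <= psi chi)%R] <= m%:E)%E.

(** If [|F1 + F2| >= t s] then [|F1| >= t s / 2] or [|F2| >= t s / 2].  The first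
    case bounds [s] by [2 I / t]; the second one bounds [s] by [2 |F2| / t]. *)
Let split_pointwise (t I : R) (F1 F2 : cplx R) (s : R) : 0 < t -> 0 < s ->
  cabs F1 <= I ->
  s ^+ 2 * [ind t <= cabs (F1 + F2) / s] <=
  s ^+ 2 * [ind s <= 2 * I / t] + 4 * t^-1 ^+ 2 * cabs F2 ^+ 2.
Proof.
move=> t0 s0 F1I; rewrite ler_pdivlMr//.
have r0 : 0 <= 4 * t^-1 ^+ 2 * cabs F2 ^+ 2.
  by rewrite mulr_ge0 ?sqr_ge0// mulr_ge0 ?sqr_ge0.
have l0 (b : bool) : 0 <= s ^+ 2 * [ind b] by rewrite mulr_ge0 ?sqr_ge0.
case: (leP (t * s) _) => [tF|_]; last by rewrite mulr0 addr_ge0.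
rewrite mulr1; case: (leP s (2 * I / t)) => [_|]; first by rewrite mulr1 lerDl.
rewrite ltr_pdivrMr// mulr0 add0r => Is.
have F2s : t * s <= 2 * cabs F2.
  by have := le_trans tF (cabsD _ _); rewrite (mulrC t s) in tF *; lra.
have -> : 4 * t^-1 ^+ 2 * cabs F2 ^+ 2 = (2 * cabs F2 / t) ^+ 2.
  by rewrite !exprMn; ring.
rewrite ler_sqr ?nnegrE ?(ltW s0) ?divr_ge0 ?mulr_ge0 ?cabs_ge0 ?(ltW t0)//.
by rewrite ler_pdivlMr// mulrC.
Qed.

(** The function is cut at the height [m t].  The large part is controlled by its
    [L^1] norm, which bounds its transform uniformly, and by the weak type of
    [psi]; the small part is controlled by Plancherel's formula. *)
Lemma fourier_weak_type (h : H -> cplx R) (t : R) :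
  cintegrable la h -> square_cintegrable h -> 0 < t ->
  (\int[pi]_chi (psi chi ^+ 2 * [ind t <= cabs (fourier la h chi) / psi chi])%:E
   <= \int[la]_x (16 * m ^+ 2 *
        (t^-1 * (cabs (h x) / m * [ind t < cabs (h x) / m]) +
         t^-1 ^+ 2 * ((cabs (h x) / m) ^+ 2 * [ind cabs (h x) / m <= t])))%:E)%E.
Proof.
move=> h1 h2 t0; have [mh hoo] := h1.
have mch := measurable_cabs mh.
have mes_u : measurable_fun [set: borel H] (fun x => cabs (h x) / m).
  by apply: measurable_funM.
have mlt : measurable_fun [set: borel H] (fun x => t < cabs (h x) / m).
  exact: measurable_fun_ltr.
have mle : measurable_fun [set: borel H] (fun x => cabs (h x) / m <= t).
  exact: measurable_fun_ler.
pose ha x := h x * [ind t < cabs (h x) / m].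
pose hb x := h x * [ind cabs (h x) / m <= t].
have hE : h = (fun x => ha x + hb x).
  apply/funext => x; rewrite /ha /hb -mulrDr.
  by case: ltP => _; rewrite ?addr0 ?add0r mulr1.
have cut_int (b : H -> bool) : measurable_fun [set: borel H] b ->
    cintegrable la (fun x => h x * [ind b x]).
  move=> mb; split; first exact: cmeasurable_ind.
  apply: le_lt_trans hoo; apply: le_integral_real => //.
  - exact/measurable_cabs/cmeasurable_ind.
  - by move=> x; exact: cabs_ge0.
  - by move=> x; rewrite cabs_ind ler_piMr ?cabs_ge0//; case: (b x).
have ia : cintegrable la ha by exact: cut_int.
have ib : cintegrable la hb by exact: cut_int.
have sb : square_cintegrable hb.
  apply: le_lt_trans h2; have [mb _] := ib; apply: le_integral_real.
  - by apply: measurable_funX; exact: measurable_cabs.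
  - by apply: measurable_funX.
  - by move=> x; exact: sqr_ge0.
  - move=> x; rewrite cabs_ind ler_sqr ?nnegrE ?mulr_ge0 ?cabs_ge0//.
    by rewrite ler_piMr ?cabs_ge0//; case: (_ <= t).
pose Ia := fine (\int[la]_x (cabs (ha x))%:E)%E.
have Ia0 : 0 <= Ia.
  by rewrite fine_ge0//; apply: integral_ge0 => x _; rewrite lee_fin cabs_ge0.
have IaE : (\int[la]_x (cabs (ha x))%:E = Ia%:E)%E.
  rewrite fineK// ge0_fin_numE; first by have [] := ia.
  by apply: integral_ge0 => x _; rewrite lee_fin cabs_ge0.
have mF := measurable_cabs (fourier_cmeasurable la_radon h1).
have mFb := measurable_cabs (fourier_cmeasurable la_radon ib).
have mpsi2 (b : hg_dual H -> bool) : measurable_fun [set: borel (hg_dual H)] b ->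
    measurable_fun [set: borel (hg_dual H)] (fun chi => psi chi ^+ 2 * [ind b chi]).
  move=> mb; apply: measurable_funM; first exact: measurable_funX.
  exact: measurable_boolr.
have mpsile : measurable_fun [set: borel (hg_dual H)]
    (fun chi => psi chi <= 2 * Ia / t) by exact: measurable_fun_ler.
have mFb2 : measurable_fun [set: borel (hg_dual H)]
    (fun chi => cabs (fourier la hb chi) ^+ 2) by exact: measurable_funX.
apply: (@le_trans _ _ (\int[pi]_chi (psi chi ^+ 2 * [ind psi chi <= 2 * Ia / t] +
    4 * t^-1 ^+ 2 * cabs (fourier la hb chi) ^+ 2)%:E)%E).
  apply: le_integral_real.
  - apply: mpsi2; rewrite (_ : (fun chi => _) =
        (fun chi => t * psi chi <= cabs (fourier la h chi))).
      by apply: measurable_fun_ler => //; exact: measurable_funM.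
    by apply/funext => chi; rewrite ler_pdivlMr.
  - apply: measurable_funD; first exact: mpsi2.
    exact: measurable_funM.
  - by move=> chi; rewrite mulr_ge0 ?sqr_ge0.
  - move=> chi; rewrite {1}hE fourierD//; apply: split_pointwise => //.
    by rewrite -lee_fin -IaE cabs_fourier_le.
have c0 : 0 <= 4 * t^-1 ^+ 2 by rewrite mulr_ge0 ?sqr_ge0.
rewrite integralD_real; last 4 first.
- exact: mpsi2.
- exact: measurable_funM.
- by move=> chi; rewrite mulr_ge0 ?sqr_ge0.
- by move=> chi; rewrite mulr_ge0 ?sqr_ge0.
rewrite [X in (_ + X <= _)%E]integralZ_real//; last by move=> chi; exact: sqr_ge0.
rewrite plancherel//.
have s0 : 0 <= 2 * Ia / t by rewrite divr_ge0 ?mulr_ge0 ?(ltW t0).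
apply: le_trans (leeD2r _ (weak_type_integral_sqr_le mpsi psi0 (ltW m0) weak_psi s0)) _.
have [mha _] := ia; have [mhb _] := ib.
have mca := measurable_cabs mha.
have mcb2 : measurable_fun [set: borel H] (fun x => cabs (hb x) ^+ 2).
  by apply: measurable_funX; exact: measurable_cabs.
have -> : 8 * m * (2 * Ia / t) = 16 * m * t^-1 * Ia by ring.
have c1 : 0 <= 16 * m * t^-1 by rewrite !mulr_ge0 ?invr_ge0 ?(ltW m0) ?(ltW t0).
rewrite EFinM -IaE -!integralZ_real//; last 2 first.
- by move=> x; exact: sqr_ge0.
- by move=> x; exact: cabs_ge0.
rewrite -integralD_real; last 4 first.
- exact: measurable_funM.
- exact: measurable_funM.
- by move=> x; rewrite mulr_ge0 ?cabs_ge0.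
- by move=> x; rewrite mulr_ge0 ?sqr_ge0.
apply: le_integral_real.
- by apply: measurable_funD; exact: measurable_funM.
- apply: measurable_funM => //; apply: measurable_funD; apply: measurable_funM => //.
    by apply: measurable_funM => //; exact: measurable_boolr.
  by apply: measurable_funM; [exact: measurable_funX|exact: measurable_boolr].
- by move=> x; rewrite addr_ge0// mulr_ge0 ?cabs_ge0 ?sqr_ge0.
move=> x; rewrite /ha /hb !cabs_ind.
have mn0 : m != 0 by rewrite gt_eqF.
case: ltP => _ /=; rewrite ?mulr0 ?mulr1 ?expr0n/= ?mulr0 ?addr0 ?add0r.
- rewrite le_eqVlt; apply/orP; left; apply/eqP; field.
  by rewrite mn0 gt_eqF.
- have -> : 16 * m ^+ 2 * (t^-1 ^+ 2 * (cabs (h x) / m) ^+ 2) =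
      16 * (t^-1 ^+ 2 * cabs (h x) ^+ 2).
    by field; rewrite mn0 gt_eqF.
  have : 0 <= t^-1 ^+ 2 * cabs (h x) ^+ 2 by rewrite mulr_ge0 ?sqr_ge0.
  by rewrite -mulrA; lra.
Qed.

End weak_type.

(** Interpolation is applied with [u = |h| / m], [v = |h^| / psi] and
    [w = psi^2]; dividing by [m] turns the cut at height [m t] into the cut of [u]
    at height [t]. *)
Lemma paley_L1_L2 (p : R) : 1 < p -> p <= 2 ->
  exists2 K : R, 0 < K & forall (psi : hg_dual H -> R) (m : R),
    measurable_fun [set: borel (hg_dual H)] psi -> (forall chi, 0 < psi chi) ->
    0 < m ->
    (forall t, (0 < t)%R -> (t%:E * pi [set chi | (t <= psi chi)%R] <= m%:E)%E) ->
    forall h, cintegrable la h -> square_cintegrable h ->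
    (\int[pi]_chi (cabs (fourier la h chi) `^ p * psi chi `^ (2 - p))%:E <=
     (K * m `^ (2 - p))%:E * \int[la]_x (cabs (h x) `^ p)%:E)%E.
Proof.
move=> p1; rewrite le_eqVlt => /predU1P[->|p2].
  exists 1 => // psi m mpsi psi0 m0 _ h h1 h2.
  rewrite subrr powRr0 mulr1 mul1e.
  under [leRHS]eq_integral do rewrite powR_mulrn ?cabs_ge0//.
  rewrite -plancherel//.
  by under eq_integral do rewrite powRr0 mulr1 powR_mulrn ?cabs_ge0//.
have C0 := interpolation_constant_gt0 p1 p2.
exists (16 * interpolation_constant p); first by rewrite mulr_gt0.
move=> psi m mpsi psi0 m0 weak h h1 h2; have [mh _] := h1.
have mF := measurable_cabs (fourier_cmeasurable la_radon h1).
have mch := measurable_cabs mh.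
have mup : measurable_fun [set: borel H] (fun x => cabs (h x) `^ p).
  exact: (measurableT_comp (measurable_powR p)).
have p0 : 0 < p by rewrite (lt_trans ltr01).
have marcinkiewicz : (\int[pi]_chi
      ((cabs (fourier la h chi) / psi chi) `^ p * psi chi ^+ 2)%:E <=
    (16 * m ^+ 2 * interpolation_constant p)%:E *
      \int[la]_x ((cabs (h x) / m) `^ p)%:E)%E.
  apply: (@marcinkiewicz_interpolation _ _ _ _ R la pi (fun x => cabs (h x) / m)
    (fun chi => cabs (fourier la h chi) / psi chi) (fun chi => psi chi ^+ 2)) => //.
  - by apply: measurable_funM.
  - apply: measurable_funM => //.
    rewrite (_ : (fun chi => _) = (fun chi => psi chi `^ (-1))).
      exact: (measurableT_comp (measurable_powR (-1))).
    by apply/funext => chi; rewrite powR_inv1 ?(ltW (psi0 _)).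
  - by apply: measurable_funX.
  - by move=> x; rewrite divr_ge0 ?cabs_ge0 ?ltW.
  - by move=> chi; rewrite divr_ge0 ?cabs_ge0 ?ltW.
  - by move=> chi; rewrite sqr_ge0.
  - by rewrite mulr_ge0 ?sqr_ge0.
  - by move=> t t0; exact: fourier_weak_type.
have -> : (\int[pi]_chi (cabs (fourier la h chi) `^ p * psi chi `^ (2 - p))%:E =
    \int[pi]_chi ((cabs (fourier la h chi) / psi chi) `^ p * psi chi ^+ 2)%:E)%E.
  apply: eq_integral => chi _; have s0 := psi0 chi.
  rewrite powRM ?cabs_ge0 ?invr_ge0 ?(ltW s0)// -mulrA; congr (_ * _)%:E.
  rewrite -powR_inv1 ?(ltW s0)// -powRrM mulN1r -powR_mulrn ?(ltW s0)//.
  by rewrite -powRD ?(gt_eqF s0) ?implybT// addrC.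
have scaleE : (\int[la]_x ((cabs (h x) / m) `^ p)%:E =
    (m `^ (- p))%:E * \int[la]_x (cabs (h x) `^ p)%:E)%E.
  rewrite -integralZ_real ?powR_ge0//; last by move=> x; exact: powR_ge0.
  apply: eq_integral => x _; rewrite powRM ?cabs_ge0 ?invr_ge0 ?(ltW m0)// mulrC.
  by rewrite -powR_inv1 ?(ltW m0)// -powRrM mulN1r.
move: marcinkiewicz; rewrite scaleE muleA -EFinM.
suff -> : 16 * m ^+ 2 * interpolation_constant p * m `^ (- p) =
    16 * interpolation_constant p * m `^ (2 - p) by [].
by rewrite powRD ?(gt_eqF m0) ?implybT// powR_mulrn ?(ltW m0)//; ring.
Qed.

End paley_inequality.

(** * Passage to the limit in L^p *)

Section power_inequalities.
Variable R : realType.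
Implicit Types a b p q : R.

Lemma powRD_le a b p : 0 <= a -> 0 <= b -> 0 <= p ->
  (a + b) `^ p <= 2 `^ p * (a `^ p + b `^ p).
Proof.
move=> a0 b0 p0; wlog ab : a b a0 b0 / a <= b.
  move=> W; have [/W|/ltW/W] := leP a b; first exact.
  by rewrite addrC [X in _ * X]addrC; exact.
apply: (@le_trans _ _ ((2 * b) `^ p)).
  by apply: ge0_ler_powR; rewrite ?nnegrE ?mulr_ge0 ?addr_ge0//; lra.
by rewrite powRM// ler_wpM2l ?powR_ge0// lerDr powR_ge0.
Qed.

(** On a set of finite measure this makes a function that is small in [L^q] small
    in [L^p] as well. *)
Lemma powR_le_split p q (e : R) : 0 < p -> p <= q -> 0 < e ->
  exists2 c, 0 <= c & forall a, 0 <= a -> a `^ p <= e + c * a `^ q.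
Proof.
move=> p0 pq e0; pose r := e `^ p^-1; have r0 : 0 < r by exact: powR_gt0.
exists (r `^ (p - q)); first exact: powR_ge0.
move=> a a0; have [ar|ra] := leP a r.
  apply: ler_wpDr; first by rewrite mulr_ge0 ?powR_ge0.
  apply: le_trans (ge0_ler_powR (ltW p0) _ _ ar) _; rewrite ?nnegrE ?(ltW r0)//.
  by rewrite -powRrM mulVf ?gt_eqF// powRr1// ltW.
have a_gt0 : 0 < a by exact: lt_trans ra.
apply: ler_wpDl; first exact: ltW.
have -> : a `^ p = a `^ (p - q) * a `^ q.
  by rewrite -powRD ?subrK// (gt_eqF a_gt0) implybT.
rewrite ler_wpM2r ?powR_ge0//.
rewrite -(opprB q p) !powRN lef_pV2 ?posrE ?powR_gt0//.
by apply: ge0_ler_powR (ltW ra); rewrite ?subr_ge0 ?nnegrE ?(ltW r0).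
Qed.

End power_inequalities.

Lemma cLnorm_cvg0_near d (T : measurableType d) (R : realType)
    (mu : {measure set T -> \bar R}) (p : R) (f : nat -> T -> cplx R) (e : R) :
  0 < p -> (cLnorm mu p%:E (f n) @[n --> \oo] --> 0)%E -> 0 < e ->
  \forall n \near \oo, (\int[mu]_x (cabs (f n x) `^ p)%:E <= e%:E)%E.
Proof.
move=> p0 f0 e0; have r0 : 0 < e `^ p^-1 by exact: powR_gt0.
have near_le : \forall n \near \oo, (cLnorm mu p%:E (f n) <= (e `^ p^-1)%:E)%E.
  have : nbhs (0%E : \bar R) [set x | (x <= (e `^ p^-1)%:E)%E].
    exists (e `^ p^-1) => //= x; rewrite /= sub0r normrN.
    by move=> /ltW/(le_trans (ler_norm _)); rewrite lee_fin.
  by move/f0.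
apply: filterS near_le => n; rewrite cLnormE => le_r.
set I := (\int[mu]_x _)%E in le_r *.
have I0 : (0 <= I)%E by apply: integral_ge0 => x _; rewrite lee_fin powR_ge0.
have -> : I = ((I `^ p^-1) `^ p)%E.
  by rewrite -poweRrM mulVf ?gt_eqF// poweRe1.
have -> : e = (e `^ p^-1) `^ p by rewrite -powRrM mulVf ?gt_eqF// powRr1// ltW.
rewrite -poweR_EFin; apply: gt0_ler_poweR le_r; first exact: ltW.
- by rewrite in_itv/= poweR_ge0 leey.
- by rewrite in_itv/= lee_fin (ltW r0) leey.
Qed.

Lemma hoelder_conjugate_fin (R : realType) (p : R) : 1 < p ->
  hoelder_conjugate p%:E = (p / (p - 1))%:E.
Proof.
move=> p1; rewrite /hoelder_conjugate/= eqe gt_eqF ?(lt_trans ltr01)//.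
by rewrite -EFinB inver gt_eqF ?subr_gt0// -EFinM.
Qed.

Lemma hoelder_conjugate_ge (R : realType) (p : R) : 1 < p -> p <= 2 ->
  p <= p / (p - 1).
Proof.
move=> p1 p2; rewrite ler_pdivlMr ?subr_gt0//; nra.
Qed.

Section extension.
Context (R : realType) (H : hypergroup R).
Variables (la : {measure set (borel H) -> \bar R})
  (pi : {measure set (borel (hg_dual H)) -> \bar R}).
Hypotheses (la_radon : radon_measure la) (la_pi : plancherel_measure la pi).

(** With [h n] and their transforms [F] approximating [f] and [g],
    [|g|^p <= 2^p (|F - g|^p + |F|^p)].  The second term is controlled by the
    inequality for [h n], and [|h n|^p] in turn by [|h n - f|^p] and [|f|^p], which
    accounts for the two factors [2^p] of the constant.  The first term tends to
    zero on each set [k^-1 <= psi <= k]. *)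
Lemma paley_Lp (p : R) : 1 < p -> p <= 2 ->
  exists2 K : R, 0 < K & forall (psi : hg_dual H -> R) (m : R),
    measurable_fun [set: borel (hg_dual H)] psi -> (forall chi, 0 < psi chi) ->
    0 < m ->
    (forall t, (0 < t)%R -> (t%:E * pi [set chi | (t <= psi chi)%R] <= m%:E)%E) ->
    forall f g, cLp la p%:E f -> Lp_fourier la pi p f g ->
    (\int[pi]_chi (cabs (g chi) `^ p * psi chi `^ (2 - p))%:E <=
     (K * m `^ (2 - p))%:E * \int[la]_x (cabs (f x) `^ p)%:E)%E.
Proof.
move=> p1 p2; have [K K0 paley] := paley_L1_L2 la_radon la_pi p1 p2.
have p0 : 0 < p by rewrite (lt_trans ltr01).
pose q := p / (p - 1).
have pq : p <= q by exact: hoelder_conjugate_ge.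
have q0 : 0 < q by exact: lt_le_trans pq.
pose a : R := 2 `^ p.
have a0 : 0 < a by exact: powR_gt0.
exists (a * a * K); first by rewrite !mulr_gt0.
move=> psi m mpsi psi0 m0 weak f g /(cLpP la f p0)[mf foo].
rewrite /Lp_fourier hoelder_conjugate_fin// -/q.
move=> [/(cLpP pi g q0)[mg _]] [h [hL hf hg]].
pose J := fine (\int[la]_x (cabs (f x) `^ p)%:E)%E.
have J0 : 0 <= J.
  by rewrite fine_ge0//; apply: integral_ge0 => x _; rewrite lee_fin powR_ge0.
have JE : (\int[la]_x (cabs (f x) `^ p)%:E = J%:E)%E.
  rewrite fineK// ge0_fin_numE//.
  by apply: integral_ge0 => x _; rewrite lee_fin powR_ge0.
have mpsip : measurable_fun [set: borel (hg_dual H)] (fun chi => psi chi `^ (2 - p)).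
  exact: (measurableT_comp (measurable_powR (2 - p))).
have p20 : 0 <= 2 - p by rewrite subr_ge0.
pose b k (chi : borel (hg_dual H)) := (k.+1%:R^-1 <= psi chi) && (psi chi <= k.+1%:R).
have mle k : measurable_fun [set: borel (hg_dual H)] (fun chi => k.+1%:R^-1 <= psi chi).
  exact: measurable_fun_ler.
have mb k : measurable_fun [set: borel (hg_dual H)] (b k).
  by apply: measurable_and => //; exact: measurable_fun_ler.
have mgp := measurable_cabs_powR p mg.
rewrite JE; apply: (integral_le_exhaustion (b := b)) => //.
- exact: measurable_funM.
- by move=> chi; rewrite mulr_ge0 ?powR_ge0.
- move=> j k chi jk /andP[lo hi]; apply/andP; split.
    by apply: le_trans lo; rewrite lef_pV2 ?posrE ?ltr0n// ler_nat ltnS.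
  by apply: le_trans hi _; rewrite ler_nat ltnS.
- by move=> chi _; exact: exists_nat_between.
move=> k; have k0 : 0 < k.+1%:R :> R by rewrite ltr0n.
pose D := a * k.+1%:R `^ (2 - p).
have D0 : 0 < D by rewrite mulr_gt0// powR_gt0.
pose Km := K * m `^ (2 - p).
have Km0 : 0 < Km by rewrite mulr_gt0// powR_gt0.
apply/lee_addgt0Pr => e e0.
(* The error is split into three parts: the values of F - g that are small, those
   that are large, and the distance from h n to f. *)
pose dl := e / 3 / (D * (k.+1%:R * m)).
have dl0 : 0 < dl by rewrite divr_gt0 ?mulr_gt0// divr_gt0.
have [c c0 split_c] := powR_le_split p0 pq dl0.
have Dc0 : 0 <= D * c by rewrite mulr_ge0// ltW.
have Ddl0 : 0 <= D * dl by rewrite mulr_ge0 ?ltW.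
have eta0 : 0 < e / 3 / (D * (c + 1)).
  by rewrite divr_gt0 ?divr_gt0// mulr_gt0// ltr_wpDl.
have eps0 : 0 < e / 3 / (a * a * Km).
  by rewrite divr_gt0 ?divr_gt0// mulr_gt0// mulr_gt0.
have [n [nhf nhg]] := filter_ex (filterI (cLnorm_cvg0_near p0 hf eps0)
  (cLnorm_cvg0_near q0 hg eta0)).
have [/cLp1P h1 /cLp2P[mh h2]] := hL n.
have mF := fourier_cmeasurable la_radon h1.
have mFg := cmeasurableB mF mg.
have mhf := cmeasurableB mh mf.
set F := fourier la (h n) in mF mFg nhg.
have le_h : (\int[la]_x (cabs (h n x) `^ p)%:E <=
    (a * (e / 3 / (a * a * Km) + J))%:E)%E.
  apply: (@le_trans _ _ (\int[la]_x
      (a * (cabs (h n x - f x) `^ p + cabs (f x) `^ p))%:E)%E).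
    apply: le_integral_real.
    - exact: measurable_cabs_powR.
    - apply: measurable_funM => //.
      by apply: measurable_funD; exact: measurable_cabs_powR.
    - by move=> x; rewrite powR_ge0.
    - move=> x; apply: le_trans (powRD_le (cabs_ge0 _) (cabs_ge0 _) (ltW p0)).
      apply: ge0_ler_powR; rewrite ?nnegrE ?addr_ge0 ?cabs_ge0 ?(ltW p0)//.
      by apply: le_trans (cabsD _ _); rewrite subrK.
  rewrite integralZ_real ?(ltW a0)//; last 2 first.
  - by apply: measurable_funD; exact: measurable_cabs_powR.
  - by move=> x; rewrite addr_ge0 ?powR_ge0.
  rewrite integralD_real; try by [exact: measurable_cabs_powR|move=> x; exact: powR_ge0].
  by rewrite JE EFinM EFinD lee_wpmul2l ?lee_fin ?(ltW a0)// leeD2r.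
have mpsiF : measurable_fun [set: borel (hg_dual H)]
    (fun chi => cabs (F chi) `^ p * psi chi `^ (2 - p)).
  by apply: measurable_funM => //; exact: measurable_cabs_powR.
have mFgq := measurable_cabs_powR q mFg.
apply: (@le_trans _ _ (\int[pi]_chi (D * dl * [ind k.+1%:R^-1 <= psi chi] +
    D * c * cabs (F chi - g chi) `^ q +
    a * (cabs (F chi) `^ p * psi chi `^ (2 - p)))%:E)%E).
  apply: le_integral_real.
  - apply: measurable_funM; first exact: measurable_funM.
    exact: measurable_boolr.
  - apply: measurable_funD; last exact: measurable_funM.
    apply: measurable_funD; last exact: measurable_funM.
    by apply: measurable_funM => //; exact: measurable_boolr.
  - by move=> chi; rewrite mulr_ge0// mulr_ge0 ?powR_ge0.
  - move=> chi; have rhs0 : 0 <= D * dl * [ind k.+1%:R^-1 <= psi chi] +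
        D * c * cabs (F chi - g chi) `^ q +
        a * (cabs (F chi) `^ p * psi chi `^ (2 - p)).
      apply: addr_ge0; first apply: addr_ge0.
      - exact: mulr_ge0.
      - by rewrite mulr_ge0 ?powR_ge0.
      - by rewrite mulr_ge0 ?(ltW a0)// mulr_ge0 ?powR_ge0.
    rewrite {1}/b; case: (boolP (_ && _)) => [/andP[lo hi]|_]; last by rewrite mulr0.
    rewrite lo !mulr1.
    have s_le : psi chi `^ (2 - p) <= k.+1%:R `^ (2 - p).
      by apply: ge0_ler_powR; rewrite ?nnegrE ?(ltW (psi0 _)) ?(ltW k0).
    have g_le : cabs (g chi) `^ p <=
        a * (cabs (F chi - g chi) `^ p + cabs (F chi) `^ p).
      apply: le_trans (powRD_le (cabs_ge0 _) (cabs_ge0 _) (ltW p0)).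
      apply: ge0_ler_powR; rewrite ?nnegrE ?addr_ge0 ?cabs_ge0 ?(ltW p0)//.
      rewrite -[X in X + _]cabsN; apply: le_trans (cabsD _ _).
      by rewrite opprB subrK.
    apply: le_trans (ler_wpM2r (powR_ge0 _ _) g_le) _.
    rewrite mulrDr mulrDl -[X in _ + X <= _]mulrA lerD2r.
    have := split_c _ (cabs_ge0 (F chi - g chi)) => d_le.
    rewrite -[D * c * _]mulrA -mulrDr /D -!mulrA ler_wpM2l ?(ltW a0)//.
    by rewrite mulrC ler_pM ?powR_ge0.
have mind : measurable_fun [set: borel (hg_dual H)]
    (fun chi => [ind k.+1%:R^-1 <= psi chi] : R) by exact: measurable_boolr.
rewrite integralD_real; last 4 first.
- by apply: measurable_funD; exact: measurable_funM.
- exact: measurable_funM.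
- by move=> chi; rewrite addr_ge0// mulr_ge0 ?powR_ge0.
- by move=> chi; rewrite mulr_ge0 ?(ltW a0)// mulr_ge0 ?powR_ge0.
rewrite integralD_real; last 4 first.
- exact: measurable_funM.
- exact: measurable_funM.
- by move=> chi; rewrite mulr_ge0.
- by move=> chi; rewrite mulr_ge0 ?powR_ge0.
rewrite [X in (_ + X <= _)%E]integralZ_real ?(ltW a0)//; last first.
  by move=> chi; rewrite mulr_ge0 ?powR_ge0.
rewrite [X in (_ + X + _ <= _)%E]integralZ_real//; last first.
  by move=> chi; rewrite powR_ge0.
rewrite [X in (X + _ + _ <= _)%E]integralZ_real//.
have pi_k : (\int[pi]_chi ([ind k.+1%:R^-1 <= psi chi])%:E <= (k.+1%:R * m)%:E)%E.
  have kV0 : 0 < k.+1%:R^-1 :> R by rewrite invr_gt0.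
  have k0E : (0 <= (k.+1%:R)%:E :> \bar R)%E by rewrite lee_fin ltW.
  have := lee_wpmul2l k0E (weak _ kV0).
  by rewrite integral_ind// muleA -EFinM mulfV ?gt_eqF// mul1e -EFinM.
have Km0E : (0 <= Km%:E)%E by rewrite lee_fin ltW.
have last_le := le_trans (paley psi m mpsi psi0 m0 weak (h n) h1 h2)
  (lee_wpmul2l Km0E le_h).
apply: (@le_trans _ _ ((D * dl)%:E * (k.+1%:R * m)%:E +
    (D * c)%:E * (e / 3 / (D * (c + 1)))%:E +
    a%:E * ((Km)%:E * (a * (e / 3 / (a * a * Km) + J))%:E))%E).
  apply: leeD; first (apply: leeD; apply: lee_wpmul2l; rewrite ?lee_fin//).
  by apply: lee_wpmul2l; [rewrite lee_fin ltW|exact: last_le].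
rewrite -!EFinM -!EFinD lee_fin.
have E1 : D * dl * (k.+1%:R * m) = e / 3.
  by rewrite /dl; field; rewrite !gt_eqF// mulr_gt0.
have E2 : D * c * (e / 3 / (D * (c + 1))) <= e / 3.
  have -> : D * c * (e / 3 / (D * (c + 1))) = e / 3 * c / (c + 1).
    by field; rewrite !gt_eqF// ltr_wpDl.
  by rewrite ler_pdivrMr ?ltr_wpDl// ler_pM2l ?divr_gt0// lerDl.
have E3 : a * (Km * (a * (e / 3 / (a * a * Km) + J))) = e / 3 + a * a * Km * J.
  by field; rewrite !gt_eqF.
rewrite E1 E3 -/Km -(mulrA (a * a) K) -/Km; lra.
Qed.

End extension.

Theorem theorem1p1 (R : realType) (H : hypergroup R)
    (la : {measure set (borel H) -> \bar R})
    (pi : {measure set (borel (hg_dual H)) -> \bar R}) (p : R) :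
  commutative_hypergroup H ->
  haar_measure la ->
  plancherel_measure la pi ->
  1 < p -> p <= 2 ->
  exists C : R, 0 < C /\
    forall psi : hg_dual H -> R,
      measurable_fun [set: borel (hg_dual H)] psi ->
      (forall chi, 0 < psi chi) ->
      (weak_sup pi psi < +oo)%E ->
      forall (f : H -> cplx R) (fhat : hg_dual H -> cplx R),
        cLp la p%:E f ->
        Lp_fourier la pi p f fhat ->
        ((\int[pi]_chi (cabs (fhat chi) `^ p * psi chi `^ (2 - p))%:E) `^ p^-1
         <= C%:E * weak_sup pi psi `^ ((2 - p) / p) * cLnorm la p%:E f)%E.
Proof.
move=> _ [la_radon _ _] la_pi p1 p2.
have [K K0 paley] := paley_Lp la_radon la_pi p1 p2.
have p0 : 0 < p by rewrite (lt_trans ltr01).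
exists (K `^ p^-1); split; first exact: powR_gt0.
move=> psi mpsi psi0 psioo f g fLp fg.
have weak t : 0 < t -> (t%:E * pi [set chi | (t <= psi chi)%R] <= weak_sup pi psi)%E.
  by move=> t0; apply: ereal_sup_ubound; exists t.
have M0 : (0 <= weak_sup pi psi)%E.
  by apply: le_trans (weak 1 ltr01); rewrite mul1e.
have ME : (weak_sup pi psi = (fine (weak_sup pi psi))%:E)%E.
  by rewrite fineK// ge0_fin_numE.
move: (fine _) ME => M ME; rewrite ME in weak M0 *; rewrite lee_fin in M0.
have [mf foo] := (cLpP la f p0).1 fLp.
set J := (\int[la]_x (cabs (f x) `^ p)%:E)%E in foo.
have J0 : (0 <= J)%E by apply: integral_ge0 => x _; rewrite lee_fin powR_ge0.
set I := (\int[pi]_chi _)%E.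
have I0 : (0 <= I)%E.
  by apply: integral_ge0 => x _; rewrite lee_fin mulr_ge0 ?powR_ge0.
have le_M : (I <= (K * M `^ (2 - p))%:E * J)%E.
  have le_m m : 0 < m -> M <= m -> (I <= (K * m `^ (2 - p))%:E * J)%E.
    move=> m0 Mm; apply: paley => // t t0.
    by apply: le_trans (weak t t0) _; rewrite lee_fin.
  have [M_gt0|] := ltP 0 M; first exact: le_m.
  move=> M_le0; have -> : M = 0 by apply/eqP; rewrite eq_le M_le0.
  have [p2E|p2n] := eqVneq (2 - p) 0.
    by have := le_m 1 ltr01; rewrite p2E !powRr0; apply; exact: le_trans ler01.
  (* When M = 0, any positive m is a bound, and m^(2-p) tends to 0 with m. *)
  have a0 : 0 < 2 - p by rewrite lt_neqAle eq_sym p2n subr_ge0.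
  rewrite powR0// mulr0 mul0e; apply/lee_addgt0Pr => e e0; rewrite add0e.
  have JE : (J = (fine J)%:E)%E by rewrite fineK// ge0_fin_numE.
  have j0 : 0 <= fine J by exact: fine_ge0.
  pose c := K * fine J + 1.
  have c0 : 0 < c by rewrite ltr_wpDl// mulr_ge0// ltW.
  have := le_m ((e / c) `^ (2 - p)^-1) (powR_gt0 _ (divr_gt0 e0 c0)).
  move=> /(_ (le_trans M_le0 (powR_ge0 _ _))); move=> /le_trans; apply.
  rewrite -powRrM mulVf// powRr1 ?(ltW (divr_gt0 e0 c0))// JE -EFinM lee_fin.
  rewrite mulrAC mulrA ler_pdivrMr// mulrC ler_pM2l// lerDl.
  exact: ler01.
have le_p := gt0_ler_poweR (ltW (_ : 0 < p^-1)) _ _ le_M.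
apply: le_trans (le_p _ _ _) _.
- by rewrite invr_gt0.
- by rewrite in_itv/= I0 leey.
- by rewrite in_itv/= mule_ge0 ?leey// lee_fin mulr_ge0 ?powR_ge0// ltW.
rewrite poweRM//; last by rewrite lee_fin mulr_ge0 ?powR_ge0// ltW.
rewrite poweR_EFin powRM ?powR_ge0 ?(ltW K0)// -powRrM cLnormE -/J.
by rewrite poweR_EFin -EFinM.
Qed.
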